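(* Let $L$ be the Lie ring over $\mathbb{Z}$ generated by $a,b,c,d,e$ subject to the relations $$[b,a]=0,\quad [c,a]=0,\quad [e,c]=0,\quad [e,d]=0,\quad [d,a]=[c,b],\quad [d,b]=[e,a],\quad [d,c]=[e,b].$$ Then for every integer $i$ with $1\le i\le 67$, the additive group of the $i$th lower central factor of $L$ satisfies $$L^{i}/L^{i+1}\cong\begin{cases} C_{i/2}\oplus C_\infty\oplus C_\infty\oplus C_\infty & \text{if } i \text{ is even},\\ C_\infty\oplus C_\infty\oplus C_\infty\oplus C_\infty\oplus C_\infty & \text{if } i \text{ is odd}.\end{cases}$$
   Context: $L^i$ denotes the $i$th term of the lower central series: $L^1=L$, $L^{i+1}=[L^i,L]$. $C_n$ denotes the cyclic group of order $n$ (so $C_1$ is trivial) and $C_\infty$ the infinite cyclic group. *)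

(* Defs.v *)
From HB Require Import structures.
From mathcomp Require Export all_boot all_order all_algebra.
From mathcomp Require Export boolp.

Set Implicit Arguments.
Unset Strict Implicit.
Unset Printing Implicit Defensive.

Import GRing.Theory.
Local Open Scope ring_scope.
Local Open Scope quotient_scope.

HB.mixin Record Zmodule_isLieRing L of GRing.Zmodule L := {
  lie : L -> L -> L;
  lieDl : forall x y z : L, lie (x + y) z = lie x z + lie y z;
  lieDr : forall x y z : L, lie x (y + z) = lie x y + lie x z;
  liexx : forall x : L, lie x x = 0;
  lie_jacobi : forall x y z : L,
    lie x (lie y z) + lie y (lie z x) + lie z (lie x y) = 0
}.

#[short(type="lieRingType")]
HB.structure Definition LieRing :=
  { L of Zmodule_isLieRing L & GRing.Zmodule L }.

(* Subgroups are boolean predicates, as MathComp's zmodClosed, subtypes and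
   quotients require; classical logic makes this no restriction. *)
Section Subgroups.
Variable V : zmodType.

Inductive in_zspan (S : V -> Prop) : V -> Prop :=
| in_zspan_gen x : S x -> in_zspan S x
| in_zspan0 : in_zspan S 0
| in_zspanB x y : in_zspan S x -> in_zspan S y -> in_zspan S (x - y).

Definition zspan (S : V -> Prop) : {pred V} := fun x => `[< in_zspan S x >].

Lemma zspan_zmod_closed S : zmod_closed (zspan S).
Proof.
split; first exact/asboolP/in_zspan0.
by move=> x y /asboolP Sx /asboolP Sy; apply/asboolP/in_zspanB.
Qed.

Variable A : zmodClosed V.

Definition subgroup := {x : V | x \in A}.
HB.instance Definition _ := SubChoice.on subgroup.
HB.instance Definition _ := [SubChoice_isSubZmodule of subgroup by <:].

Variable B : zmodClosed V.

Definition trace : {pred subgroup} := fun u => val u \in B.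

Lemma trace_zmod_closed : zmod_closed trace.
Proof.
by split=> [|x y Bx By]; rewrite unfold_in /trace ?raddf0 ?raddfB ?rpred0 ?rpredB.
Qed.

HB.instance Definition _ :=
  GRing.isZmodClosed.Build subgroup trace trace_zmod_closed.

(* A / B when B is a subgroup of A; in general A / (A :&: B). *)
Definition subquotient := Quotient.quot trace.
HB.instance Definition _ := GRing.Zmodule.on subquotient.

End Subgroups.

Definition zmod_isog (V W : zmodType) : Prop :=
  exists f : {additive V -> W}, bijective f.

(* C_n for n > 0; unlike 'Z_n, this is the trivial group when n = 1. *)
Definition cyclic_zmod (n : nat) : zmodType := 'I_n.-1.+1.

Section LowerCentralSeries.
Variable L : lieRingType.

Definition lie_span (A B : {pred L}) : {pred L} :=
  zspan (fun z => exists x y : L, [/\ x \in A, y \in B & z = lie x y]).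

(* lcs i is L^i for i >= 1; the value lcs 0 = L is a convention. *)
Fixpoint lcs (i : nat) : {pred L} :=
  if i is (_.+1 as j).+1 then lie_span (lcs j) predT else predT.

Lemma lcs_zmod_closed i : zmod_closed (lcs i).
Proof. by case: i => [|[|i]] //; apply: zspan_zmod_closed. Qed.

HB.instance Definition _ i :=
  GRing.isZmodClosed.Build L (lcs i) (lcs_zmod_closed i).

Definition lcs_factor (i : nat) : zmodType := subquotient (lcs i) (lcs i.+1).

End LowerCentralSeries.

Inductive lie_term (X : Type) : Type :=
| TGen of X
| TZero
| TOpp of lie_term X
| TAdd of lie_term X & lie_term X
| TLie of lie_term X & lie_term X.
Arguments TZero {X}.
HB.instance Definition _ X := gen_eqMixin (lie_term X).
HB.instance Definition _ X := gen_choiceMixin (lie_term X).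

Fixpoint lie_eval (X : Type) (M : lieRingType) (v : X -> M) (t : lie_term X) : M :=
  match t with
  | TGen x => v x
  | TZero => 0
  | TOpp s => - lie_eval v s
  | TAdd s u => lie_eval v s + lie_eval v u
  | TLie s u => lie (lie_eval v s) (lie_eval v u)
  end.

(* The Lie ring generated by X subject to the relations s = t, for (s, t) in
   rels: Lie terms modulo the congruence generated by the Lie ring axioms and
   rels.  It is characterised by presented_universal below. *)
Section Presentation.
Variables (X : Type) (rels : seq (lie_term X * lie_term X)).

Local Notation term := (lie_term X).

Inductive lie_cong : term -> term -> Prop :=
| cong_refl s : lie_cong s s
| cong_sym s t : lie_cong s t -> lie_cong t s
| cong_trans s t u : lie_cong s t -> lie_cong t u -> lie_cong s u
| cong_opp s s' : lie_cong s s' -> lie_cong (TOpp s) (TOpp s')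
| cong_add s s' t t' : lie_cong s s' -> lie_cong t t' ->
    lie_cong (TAdd s t) (TAdd s' t')
| cong_lie s s' t t' : lie_cong s s' -> lie_cong t t' ->
    lie_cong (TLie s t) (TLie s' t')
| cong_addA s t u : lie_cong (TAdd s (TAdd t u)) (TAdd (TAdd s t) u)
| cong_addC s t : lie_cong (TAdd s t) (TAdd t s)
| cong_add0 s : lie_cong (TAdd TZero s) s
| cong_addN s : lie_cong (TAdd (TOpp s) s) TZero
| cong_lieDl s t u : lie_cong (TLie (TAdd s t) u) (TAdd (TLie s u) (TLie t u))
| cong_lieDr s t u : lie_cong (TLie s (TAdd t u)) (TAdd (TLie s t) (TLie s u))
| cong_liexx s : lie_cong (TLie s s) TZero
| cong_jacobi s t u :
    lie_cong (TAdd (TAdd (TLie s (TLie t u)) (TLie t (TLie u s)))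
                   (TLie u (TLie s t))) TZero
| cong_rel s t : (s, t) \in rels -> lie_cong s t.

Definition lie_congb : rel term := fun s t => `[< lie_cong s t >].

Lemma lie_congb_equiv : equiv_class_of lie_congb.
Proof.
split=> [s|s t|t s u]; first exact/asboolP/cong_refl.
  by apply/asboolP/asboolP => /cong_sym.
by move=> /asboolP st /asboolP tu; apply/asboolP/(cong_trans st tu).
Qed.

Canonical lie_congb_equivRel := EquivRelPack lie_congb_equiv.
Canonical lie_congb_encModRel := defaultEncModRel lie_congb.

Definition presented := {eq_quot lie_congb}.
HB.instance Definition _ : EqQuotient term lie_congb presented :=
  EqQuotient.on presented.
HB.instance Definition _ := Choice.on presented.

Local Notation cls := (\pi_presented : term -> presented).

Lemma presentedE s t : cls s = cls t <-> lie_cong s t.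
Proof.
by split=> [/eqP|st]; [|apply/eqP]; rewrite piE; [move/asboolP | apply/asboolP].
Qed.

Lemma cong_repr s : lie_cong (repr (cls s)) s.
Proof. by apply/presentedE; rewrite reprK. Qed.

Definition pzero : presented := cls TZero.
Definition popp (x : presented) : presented := cls (TOpp (repr x)).
Definition padd (x y : presented) : presented := cls (TAdd (repr x) (repr y)).
Definition plie (x y : presented) : presented := cls (TLie (repr x) (repr y)).

Lemma cls_opp s : popp (cls s) = cls (TOpp s).
Proof. by apply/presentedE/cong_opp/cong_repr. Qed.

Lemma cls_add s t : padd (cls s) (cls t) = cls (TAdd s t).
Proof. by apply/presentedE/cong_add; apply: cong_repr. Qed.

Lemma cls_lie s t : plie (cls s) (cls t) = cls (TLie s t).
Proof. by apply/presentedE/cong_lie; apply: cong_repr. Qed.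

Lemma paddA : associative padd.
Proof.
move=> x y z; elim/quotW: x => s; elim/quotW: y => t; elim/quotW: z => u.
rewrite (cls_add t u) (cls_add s t) (cls_add s (TAdd t u)) (cls_add (TAdd s t) u).
exact/presentedE/cong_addA.
Qed.

Lemma paddC : commutative padd.
Proof.
move=> x y; elim/quotW: x => s; elim/quotW: y => t.
rewrite (cls_add s t) (cls_add t s); exact/presentedE/cong_addC.
Qed.

Lemma padd0 : left_id pzero padd.
Proof.
by elim/quotW=> s; rewrite (cls_add TZero s); apply/presentedE/cong_add0.
Qed.

Lemma paddN : left_inverse pzero popp padd.
Proof.
elim/quotW=> s; rewrite (cls_opp s) (cls_add (TOpp s) s).
exact/presentedE/cong_addN.
Qed.

HB.instance Definition _ := GRing.isZmodule.Build presented paddA paddC padd0 paddN.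

Lemma cls_oppr s : - cls s = cls (TOpp s). Proof. exact: cls_opp. Qed.

Lemma cls_addr s t : cls s + cls t = cls (TAdd s t). Proof. exact: cls_add. Qed.

Lemma plieDl (x y z : presented) : plie (x + y) z = plie x z + plie y z.
Proof.
elim/quotW: x => s; elim/quotW: y => t; elim/quotW: z => u.
rewrite (cls_addr s t) (cls_lie s u) (cls_lie t u) (cls_lie (TAdd s t) u).
rewrite (cls_addr (TLie s u) (TLie t u)); exact/presentedE/cong_lieDl.
Qed.

Lemma plieDr (x y z : presented) : plie x (y + z) = plie x y + plie x z.
Proof.
elim/quotW: x => s; elim/quotW: y => t; elim/quotW: z => u.
rewrite (cls_addr t u) (cls_lie s t) (cls_lie s u) (cls_lie s (TAdd t u)).
rewrite (cls_addr (TLie s t) (TLie s u)); exact/presentedE/cong_lieDr.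
Qed.

Lemma pliexx (x : presented) : plie x x = 0.
Proof.
by elim/quotW: x => s; rewrite (cls_lie s s); apply/presentedE/cong_liexx.
Qed.

Lemma plie_jacobi (x y z : presented) :
  plie x (plie y z) + plie y (plie z x) + plie z (plie x y) = 0.
Proof.
elim/quotW: x => s; elim/quotW: y => t; elim/quotW: z => u.
rewrite (cls_lie t u) (cls_lie u s) (cls_lie s t).
rewrite (cls_lie s (TLie t u)) (cls_lie t (TLie u s)) (cls_lie u (TLie s t)).
rewrite (cls_addr (TLie s (TLie t u)) (TLie t (TLie u s))).
rewrite (cls_addr (TAdd _ _) (TLie u (TLie s t))).
exact/presentedE/cong_jacobi.
Qed.

HB.instance Definition _ :=
  Zmodule_isLieRing.Build presented plieDl plieDr pliexx plie_jacobi.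

Lemma cls_lier s t : lie (cls s) (cls t) = cls (TLie s t).
Proof. exact: cls_lie. Qed.

Definition pgen (x : X) : presented := cls (TGen x).

Lemma lie_eval_pgen t : lie_eval pgen t = cls t.
Proof.
elim: t => [x||s IH|s IHs t IHt|s IHs t IHt] //=.
- by rewrite IH cls_oppr.
- by rewrite IHs IHt cls_addr.
- by rewrite IHs IHt cls_lier.
Qed.

Lemma pgen_rels s t : (s, t) \in rels -> lie_eval pgen s = lie_eval pgen t.
Proof. by move=> st; rewrite !lie_eval_pgen; apply/presentedE/cong_rel. Qed.

Theorem presented_universal (M : lieRingType) (v : X -> M) :
  (forall s t, (s, t) \in rels -> lie_eval v s = lie_eval v t) ->
  let lie_ext (f : {additive presented -> M}) :=
    (forall x y, f (lie x y) = lie (f x) (f y)) /\ (forall x, f (pgen x) = v x) in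
  exists2 f, lie_ext f & forall h, lie_ext h -> h =1 f.
Proof.
move=> vrels lie_ext.
have ev s t : lie_cong s t -> lie_eval v s = lie_eval v t.
  elim=> //= {s t}.
  - by move=> s t u _ -> _ ->.
  - by move=> s s' _ ->.
  - by move=> s s' t t' _ -> _ ->.
  - by move=> s s' t t' _ -> _ ->.
  - by move=> s t u; rewrite addrA.
  - by move=> s t; rewrite addrC.
  - by move=> s; rewrite add0r.
  - by move=> s; rewrite addNr.
  - by move=> s t u; rewrite lieDl.
  - by move=> s t u; rewrite lieDr.
  - by move=> s; rewrite liexx.
  - by move=> s t u; rewrite lie_jacobi.
pose g (x : presented) := lie_eval v (repr x).
have gE s : g (cls s) = lie_eval v s by exact/ev/cong_repr.
have gB : zmod_morphism g.
  move=> x y; elim/quotW: x => s; elim/quotW: y => t.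
  by rewrite (cls_oppr t) (cls_addr s (TOpp t)) !gE.
pose gA := GRing.isZmodMorphism.Build presented M g gB.
pose f : {additive presented -> M} := HB.pack g gA.
exists f => [|h [hlie hgen] x].
  split=> [x y|x]; last exact: gE.
  elim/quotW: x => s; elim/quotW: y => t.
  by rewrite (cls_lier s t) /= !gE.
elim/quotW: x => s0; rewrite [f _]gE -lie_eval_pgen.
elim: s0 => [z||s IH|s IHs t IHt|s IHs t IHt] /=.
- by rewrite hgen.
- by rewrite raddf0.
- by rewrite raddfN IH.
- by rewrite raddfD IHs IHt.
- by rewrite hlie IHs IHt.
Qed.

End Presentation.

Inductive gen5 : Type := ga | gb | gc | gd | ge.

Definition rels7 : seq (lie_term gen5 * lie_term gen5) :=
  let a := TGen ga in let b := TGen gb in let c := TGen gc in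
  let d := TGen gd in let e := TGen ge in
  [:: (TLie b a, TZero);
      (TLie c a, TZero);
      (TLie e c, TZero);
      (TLie e d, TZero);
      (TLie d a, TLie c b);
      (TLie d b, TLie e a);
      (TLie d c, TLie e b)].

Definition Lie57 : lieRingType := presented rels7.

(* Main.v *)
From HB Require Import structures.
Require Import Defs.
From mathcomp Require Import ring zify.

Set Implicit Arguments.
Unset Strict Implicit.
Unset Printing Implicit Defensive.

Import GRing.Theory.
Local Open Scope ring_scope.
Local Open Scope quotient_scope.

(** Over the rationals, the Lie ring is the positive part of a twisted loop
    algebra of [sl_3]: with [t] a variable, the generators are
<<
      a = t E13,  b = t (E12 - E23),  c = - t E22,  d = t (E21 - E32),  e = t E31
>>
    modulo scalar matrices, the even degrees hold the fixed algebra [so_3] of an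
    involution of [sl_3], and the odd degrees its 5-dimensional complement.
    This accounts for the free parts of the factors.  Over the integers, there is
    also a central extension, by the differential forms in [t ^ 2] modulo the
    exact ones; the class of the form in degree [2n] has order [n], and
    generates the torsion.

    For the upper bound, write [x ** y] for the product and let it associate to
    the left.  There are elements [A n], ..., [E n] of degree [2n+1] and [U n],
    [V n], [W n], [Z n] of degree [2n+2] whose products by the five generators
    are given by a table that does not depend on [n], but for degree 1
    ([tables_all]).  The table in one degree follows from the table in the
    previous degree by applying the seven relators to its elements
    ([odd_of_even], [even_of_odd]), except that [C ** a = B ** b] and
    [C ** e = D ** d] are only found to be killed by 2.  They vanish because
    [x ** x = 0] for an element [x] of half the degree ([extremal_of_lower]); to
    expand this product, some products of elements of high degree are needed,
    and they satisfy a short recursion ([products_below]).  Similarly,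
    anticommutativity in degree [2n+2] yields [n.+1] times [Z n] is 0
    ([torsion]).  Since the elements of each degree are closed under multiplying
    with generators, they span the lower central factors ([lcs_spanned]).

    For the lower bound, the matrices above are extended by a [cocycle] with
    values modulo [2N+2] ([model]).  A homomorphism to this Lie ring
    respects degrees ([filt_image]), and it maps [A n], ..., [W n] to multiples
    of independent matrices and [Z N] to an element of order [N.+1]
    ([odd_comb_inj], [even_comb_inj]). *)

(** * Linear identities in abelian groups *)

(** Syntax of formal integer combinations, the basis of the decision procedure
    [zmod]: two expressions that have the same coefficient at each variable
    have the same value in every abelian group. *)
Inductive zexp : Type :=
| ZVar of nat
| ZZero
| ZOpp of zexp
| ZAdd of zexp & zexp
| ZMul of zexp & nat.

Fixpoint zeval (V : zmodType) (env : seq V) (e : zexp) : V :=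
  match e with
  | ZVar j => env`_j
  | ZZero => 0
  | ZOpp e1 => - zeval env e1
  | ZAdd e1 e2 => zeval env e1 + zeval env e2
  | ZMul e1 n => zeval env e1 *+ n
  end.

Fixpoint zcoef (e : zexp) (i : nat) : int :=
  match e with
  | ZVar j => if i == j then 1 else 0
  | ZZero => 0
  | ZOpp e1 => - zcoef e1 i
  | ZAdd e1 e2 => zcoef e1 i + zcoef e2 i
  | ZMul e1 n => zcoef e1 i *+ n
  end.

Lemma zevalE (V : zmodType) (env : seq V) (e : zexp) :
  zeval env e = \sum_(i < size env) env`_i *~ zcoef e i.
Proof.
elim: e => [j||e1 IH|e1 IH1 e2 IH2|e1 IH n] /=; rewrite ?IH ?IH1 ?IH2.
- have [ltj|gej] := ltnP j (size env).
    rewrite (bigD1 (Ordinal ltj)) //= eqxx mulr1z big1 ?addr0 // => i.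
    by rewrite -val_eqE /= => /negPf->; rewrite mulr0z.
  rewrite nth_default // big1 // => i _.
  by rewrite ltn_eqF ?mulr0z // (leq_trans (ltn_ord i)).
- by rewrite big1 // => i _; rewrite mulr0z.
- by rewrite -sumrN; apply: eq_bigr => i _; rewrite mulrNz.
- by rewrite -big_split; apply: eq_bigr => i _; rewrite /= mulrzDr.
- by rewrite -sumrMnl; apply: eq_bigr => i _; rewrite -mulr_natr mulrzA mulrz_nat.
Qed.

Lemma zeval_eq (V : zmodType) (env : seq V) (e1 e2 : zexp) :
    all (fun i => zcoef e1 i == zcoef e2 i) (iota 0 (size env)) ->
  zeval env e1 = zeval env e2.
Proof.
move=> /allP coefE; rewrite !zevalE; apply: eq_bigr => i _.
by rewrite (eqP (coefE i _)) // mem_iota add0n ltn_ord.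
Qed.

(* Structure instances reached along different inheritance paths make equal
   atoms syntactically different, hence the comparison up to conversion. *)
Ltac zmod_index x env :=
  lazymatch env with
  | ?y :: ?env' =>
      match goal with
      | _ => let _ := match goal with _ => unify x y end in constr:(0%N)
      | _ => let k := zmod_index x env' in constr:(k.+1)
      end
  end.

Ltac zmod_insert x env :=
  match goal with
  | _ => let _ := zmod_index x env in env
  | _ => constr:(x :: env)
  end.

Ltac zmod_closed_nat n :=
  lazymatch n with O => idtac | S ?m => zmod_closed_nat m end.

Ltac zmod_atoms t env :=
  lazymatch t with
  | @GRing.zero _ => env
  | @GRing.add _ ?s ?u => let env1 := zmod_atoms s env in zmod_atoms u env1
  | @GRing.opp _ ?s => zmod_atoms s env
  | @GRing.natmul _ ?s ?n =>
      match goal with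
      | _ => let _ := match goal with _ => zmod_closed_nat n end in zmod_atoms s env
      | _ => zmod_insert t env
      end
  | _ => zmod_insert t env
  end.

Ltac zmod_reify t env :=
  lazymatch t with
  | @GRing.zero _ => constr:(ZZero)
  | @GRing.add _ ?s ?u =>
      let e1 := zmod_reify s env in let e2 := zmod_reify u env in
      constr:(ZAdd e1 e2)
  | @GRing.opp _ ?s => let e1 := zmod_reify s env in constr:(ZOpp e1)
  | @GRing.natmul _ ?s ?n =>
      match goal with
      | _ => let _ := match goal with _ => zmod_closed_nat n end in
             let e1 := zmod_reify s env in constr:(ZMul e1 n)
      | _ => let k := zmod_index t env in constr:(ZVar k)
      end
  | _ => let k := zmod_index t env in constr:(ZVar k)
  end.

(** Proves an equation that holds in all abelian groups; multiples by a literal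
    natural number are interpreted, all other terms are atoms. *)
Ltac zmod :=
  lazymatch goal with
  | |- @eq ?V ?l ?r =>
      let env1 := zmod_atoms l (@nil V) in
      let env := zmod_atoms r env1 in
      let e1 := zmod_reify l env in
      let e2 := zmod_reify r env in
      change (zeval env e1 = zeval env e2);
      apply: zeval_eq; vm_compute; reflexivity
  end.

Section Combine.
Variable V : zmodType.
Implicit Types l r x y : V.

Lemma eqD l1 r1 l2 r2 : l1 = r1 -> l2 = r2 -> l1 + l2 = r1 + r2.
Proof. by move=> -> ->. Qed.

Lemma eqB l1 r1 l2 r2 : l1 = r1 -> l2 = r2 -> l1 - l2 = r1 - r2.
Proof. by move=> -> ->. Qed.

Lemma eqMn n l r : l = r -> l *+ n = r *+ n.
Proof. by move=> ->. Qed.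

Lemma zcomb l r x y : l = r -> x - y = l - r -> x = y.
Proof. by move=> ->; rewrite subrr => /subr0_eq. Qed.

End Combine.

(** Derives the goal from a proof [E] of an equation whose two sides differ by
    as much as those of the goal. *)
Ltac lincomb E := apply: (zcomb E); zmod.

(** * Left-normed products in a Lie ring *)

Local Notation "x ** y" := (lie x y) (at level 40, left associativity).

Section LieRingTheory.
Variable L : lieRingType.
Implicit Types x y z : L.

Lemma lie0l x : 0 ** x = 0.
Proof. by apply: (@addIr _ (0 ** x)); rewrite -lieDl !add0r. Qed.

Lemma lie0r x : x ** 0 = 0.
Proof. by apply: (@addIr _ (x ** 0)); rewrite -lieDr !add0r. Qed.

Lemma lieNl x y : - x ** y = - (x ** y).
Proof. by apply: (@addIr _ (x ** y)); rewrite -lieDl !addNr lie0l. Qed.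

Lemma lieNr x y : x ** - y = - (x ** y).
Proof. by apply: (@addIr _ (x ** y)); rewrite -lieDr !addNr lie0r. Qed.

Lemma lieMnl x y n : (x *+ n) ** y = (x ** y) *+ n.
Proof. by elim: n => [|n IHn]; rewrite ?lie0l // !mulrS lieDl IHn. Qed.

Lemma lie_anti x y : x ** y = - (y ** x).
Proof.
apply/eqP; rewrite -addr_eq0; apply/eqP.
by have := liexx (x + y); rewrite lieDl !lieDr !liexx add0r addr0.
Qed.

(** The Jacobi identity as a rule that expresses all products by left-normed
    ones. *)
Lemma lie_lieR x y z : x ** (y ** z) = x ** y ** z - x ** z ** y.
Proof.
have := lie_jacobi x y z.
rewrite (lie_anti y (z ** x)) (lie_anti z (x ** y)) (lie_anti z x) lieNl opprK => jac.
lincomb jac.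
Qed.

Definition lieE := (@lieDl L, lieNl, lieMnl, lie0l).

End LieRingTheory.

(** * The multiplication table *)

Record seven_relations (L : lieRingType) (a b c d e : L) : Prop :=
  SevenRelations {
    rel_ba : b ** a = 0;
    rel_ca : c ** a = 0;
    rel_ec : e ** c = 0;
    rel_ed : e ** d = 0;
    rel_da : d ** a = c ** b;
    rel_db : d ** b = e ** a;
    rel_dc : d ** c = e ** b
  }.

Section Table.
Variables (L : lieRingType) (a b c d e : L).
Variables A B C D E U V W Z : nat -> L.

(** Nine families of products of the generators: [A n], ..., [E n] have degree
    [2n+1] and [U n], ..., [Z n] have degree [2n+2].  The equations determine
    all of them, and say how each degree is built from the previous one; being
    equations, they pass to the images under homomorphisms. *)
Record table_system : Prop := TableSystem {
  A_0 : A 0%N = a;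
  B_0 : B 0%N = b;
  C_0 : C 0%N = c;
  D_0 : D 0%N = d;
  E_0 : E 0%N = e;
  U_b : forall n, U n ** b = - A n.+1;
  U_c : forall n, U n ** c = - B n.+1;
  U_d : forall n, U n ** d = C n.+1;
  W_c : forall n, W n ** c = D n.+1;
  W_d : forall n, W n ** d = E n.+1;
  B_c : forall n, B n ** c = - U n;
  C_c : forall n, C n ** c = Z n;
  D_b : forall n, D n ** b = V n + Z n;
  D_c : forall n, D n ** c = W n
}.

(** The products by generators, besides those in [table_system]: first the
    rows of degree [2n+2], then those of degree [2n+1].  The rows of [A], [C]
    and [E] differ in degree 1, where for instance [a ** d] is [- U 0]. *)
Record even_table n : Prop := EvenTable {
  U_a : U n ** a = 0;
  U_e : U n ** e = D n.+1;
  V_a : V n ** a = - A n.+1;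
  V_b : V n ** b = - B n.+1;
  V_c : V n ** c = 0;
  V_d : V n ** d = D n.+1;
  V_e : V n ** e = E n.+1;
  W_a : W n ** a = - B n.+1;
  W_b : W n ** b = - C n.+1;
  W_e : W n ** e = 0;
  Z_a : Z n ** a = 0;
  Z_b : Z n ** b = 0;
  Z_c : Z n ** c = 0;
  Z_d : Z n ** d = 0;
  Z_e : Z n ** e = 0
}.

Record BD_table n : Prop := BDTable {
  B_a : B n ** a = 0;
  B_d : B n ** d = Z n - V n;
  B_e : B n ** e = - W n;
  D_a : D n ** a = U n;
  D_e : D n ** e = 0
}.

Record ACE_table n : Prop := ACETable {
  A_a : A n ** a = 0;
  A_b : A n ** b = 0;
  A_c : A n ** c = 0;
  A_d : A n ** d = - (U n *+ 2);
  A_e : A n ** e = Z n - V n *+ 2;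
  C_b : C n ** b = U n *+ 3;
  C_d : C n ** d = - (W n *+ 3);
  E_a : E n ** a = Z n + V n *+ 2;
  E_b : E n ** b = W n *+ 2;
  E_c : E n ** c = 0;
  E_d : E n ** d = 0;
  E_e : E n ** e = 0
}.

(** The products that the relations determine only up to elements of order 2
    when the previous degree is known; [extremal_relations] is what they give. *)
Record extremal_table n : Prop := ExtremalTable {
  B_b : B n ** b = 0;
  D_d : D n ** d = 0
}.

Record extremal_relations n : Prop := ExtremalRelations {
  Ca_Bb : C n ** a = B n ** b;
  Ce_Dd : C n ** e = D n ** d;
  Bb2 : B n ** b *+ 2 = 0;
  Dd2 : D n ** d *+ 2 = 0
}.

Hypothesis rel : seven_relations a b c d e.
Hypothesis sys : table_system.

Definition sysE :=
  (U_b sys, U_c sys, U_d sys, W_c sys, W_d sys, B_c sys, C_c sys, D_b sys, D_c sys).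

(** A relation [s = t] between products of generators, with [x] multiplied
    on the left and expanded into left-normed products. *)
Lemma relr_ba x : x ** b ** a = x ** a ** b.
Proof. by apply/subr0_eq; rewrite -lie_lieR (rel_ba rel) lie0r. Qed.

Lemma relr_ca x : x ** c ** a = x ** a ** c.
Proof. by apply/subr0_eq; rewrite -lie_lieR (rel_ca rel) lie0r. Qed.

Lemma relr_ec x : x ** e ** c = x ** c ** e.
Proof. by apply/subr0_eq; rewrite -lie_lieR (rel_ec rel) lie0r. Qed.

Lemma relr_ed x : x ** e ** d = x ** d ** e.
Proof. by apply/subr0_eq; rewrite -lie_lieR (rel_ed rel) lie0r. Qed.

Lemma relr_da x : x ** d ** a - x ** a ** d = x ** c ** b - x ** b ** c.
Proof. by rewrite -!lie_lieR (rel_da rel). Qed.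

Lemma relr_db x : x ** d ** b - x ** b ** d = x ** e ** a - x ** a ** e.
Proof. by rewrite -!lie_lieR (rel_db rel). Qed.

Lemma relr_dc x : x ** d ** c - x ** c ** d = x ** e ** b - x ** b ** e.
Proof. by rewrite -!lie_lieR (rel_dc rel). Qed.

(** Applying the seven relators to [U n], [V n] and [W n] gives 21 linear
    equations for the 21 unknown products of [A n.+1], ..., [E n.+1] with
    generators.  In each weight for the grading where [a], ..., [e] have
    weights 4, 2, 0, -2, -4 they form a small system, solved below by explicit
    combinations; in the weights 4 and -4 its determinant is 2. *)
Lemma odd_of_even n : even_table n ->
  [/\ BD_table n.+1, ACE_table n.+1 & extremal_relations n.+1].
Proof.
case=> Ua Ue Va Vb Vc Vd Ve Wa Wb We _ _ _ _ _.
pose tab := (sysE, (Ua, Ue), (Va, Vb, Vc, Vd, Ve), (Wa, Wb, We)).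
have := relr_ba (U n); rewrite !(tab, lieE) => r1U.
have := relr_ca (U n); rewrite !(tab, lieE) => r2U.
have := relr_ec (U n); rewrite !(tab, lieE) => r3U.
have := relr_ed (U n); rewrite !(tab, lieE) => r4U.
have := relr_da (U n); rewrite !(tab, lieE) => r5U.
have := relr_db (U n); rewrite !(tab, lieE) => r6U.
have := relr_dc (U n); rewrite !(tab, lieE) => r7U.
have := relr_ba (V n); rewrite !(tab, lieE) => r1V.
have := relr_ca (V n); rewrite !(tab, lieE) => r2V.
have := relr_ec (V n); rewrite !(tab, lieE) => r3V.
have := relr_ed (V n); rewrite !(tab, lieE) => r4V.
have := relr_da (V n); rewrite !(tab, lieE) => r5V.
have := relr_db (V n); rewrite !(tab, lieE) => r6V.
have := relr_dc (V n); rewrite !(tab, lieE) => r7V.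
have := relr_ba (W n); rewrite !(tab, lieE) => r1W.
have := relr_ca (W n); rewrite !(tab, lieE) => r2W.
have := relr_ec (W n); rewrite !(tab, lieE) => r3W.
have := relr_ed (W n); rewrite !(tab, lieE) => r4W.
have := relr_da (W n); rewrite !(tab, lieE) => r5W.
have := relr_db (W n); rewrite !(tab, lieE) => r6W.
have := relr_dc (W n); rewrite !(tab, lieE) => r7W.
have Ba : B n.+1 ** a = 0 by lincomb (esym r2U).
have Be : B n.+1 ** e = - W n.+1 by lincomb r3U.
have Da : D n.+1 ** a = U n.+1 by lincomb r2W.
have De : D n.+1 ** e = 0 by lincomb (esym r3W).
have Ea : E n.+1 ** a = Z n.+1 + V n.+1 *+ 2 by lincomb (eqB r7U r6V).
have Bd : B n.+1 ** d = Z n.+1 - V n.+1.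
  by lincomb (eqB r5W (eqB r7U r6V)).
have Ac : A n.+1 ** c = 0 by lincomb r2V.
have Ad : A n.+1 ** d = - (U n.+1 *+ 2) by lincomb (eqB r5V Da).
have Eb : E n.+1 ** b = W n.+1 *+ 2 by lincomb (eqB (esym r7V) Be).
have Ec : E n.+1 ** c = 0 by lincomb r3V.
split; split=> //.
- by lincomb (esym r1U).
- by lincomb (eqD r1V Ba).
- by lincomb (eqB Bd r7U).
- by lincomb (eqD (eqB r6U Ad) Da).
- by lincomb (eqD (eqB r6W Eb) Be).
- by lincomb (eqD r4V De).
- by lincomb (esym r1W).
- by lincomb (eqD (eqD r5U r1W) Ac).
- by lincomb (eqD (eqD (esym r7W) r4U) Ec).
Qed.

(** The rows of [B] and [D] suffice to determine the next degree, which covers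
    degree 1, where the other rows are exceptional. *)
Lemma even_of_BD n :
    BD_table n -> extremal_table n -> V n ** c = 0 ->
    (forall g, g \in [:: a; b; c; d; e] -> Z n ** g = 0) ->
  even_table n.
Proof.
case=> Ba Bd Be Da De [Bb Dd] Vc Zg.
have Za : Z n ** a = 0 by apply: Zg; rewrite !inE eqxx.
have Zb : Z n ** b = 0 by apply: Zg; rewrite !inE eqxx orbT.
have Zc : Z n ** c = 0 by apply: Zg; rewrite !inE eqxx !orbT.
have Zd : Z n ** d = 0 by apply: Zg; rewrite !inE eqxx !orbT.
have Ze : Z n ** e = 0 by apply: Zg; rewrite !inE eqxx !orbT.
pose tab := (sysE, (Ba, Bb, Bd, Be), (Da, Dd, De), Vc, (Za, Zb, Zc, Zd, Ze)).
have := relr_ca (B n); rewrite !(tab, lieE) => r2B.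
have := relr_ec (B n); rewrite !(tab, lieE) => r3B.
have := relr_ed (B n); rewrite !(tab, lieE) => r4B.
have := relr_da (B n); rewrite !(tab, lieE) => r5B.
have := relr_db (B n); rewrite !(tab, lieE) => r6B.
have := relr_dc (B n); rewrite !(tab, lieE) => r7B.
have := relr_ca (D n); rewrite !(tab, lieE) => r2D.
have := relr_ec (D n); rewrite !(tab, lieE) => r3D.
have := relr_db (D n); rewrite !(tab, lieE) => r6D.
split=> //.
- by lincomb (esym r2B).
- by lincomb r3B.
- by lincomb (esym r5B).
- by lincomb (eqD (esym r6B) r2D).
- by lincomb (eqD (esym r6D) r3B).
- by lincomb r4B.
- by lincomb r7B.
Qed.

(** The generators kill [Z n = C n ** c]: in the relators applied to [C n], the
    other terms vanish or cancel, as they occur with the factor 3 on both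
    sides.  Only the product with [c] needs several rows of the table. *)
Lemma even_of_odd n :
    BD_table n -> ACE_table n -> extremal_table n -> extremal_relations n ->
  even_table n.
Proof.
move=> BD ACE ext wk; apply: even_of_BD => //.
all: have Ca : C n ** a = 0 by rewrite (Ca_Bb wk) (B_b ext).
all: have Ce : C n ** e = 0 by rewrite (Ce_Dd wk) (D_d ext).
all: case: BD ACE ext => Ba Bd Be Da De [Aa Ab Ac Ad Ae Cb Cd Ea Eb Ec Ed Ee] [Bb Dd].
all: pose tab := (sysE, (Aa, Ab, Ac, Ad, Ae), (Ba, Bb, Bd, Be),
  (Ca, Cb, Cd, Ce), (Da, Dd, De), (Ea, Eb, Ec, Ed, Ee)).
all: have := relr_ec (A n); rewrite !(tab, lieE) => r3A.
all: have := relr_ca (E n); rewrite !(tab, lieE) => r2E.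
all: have := relr_da (D n); rewrite !(tab, lieE) => r5D.
all: have := relr_db (C n); rewrite !(tab, lieE) => r6C.
(* The equations give 4 (V c) = 0 and 9 (V c) = 0, and 9 - 2 * 4 = 1. *)
all: have Vc : V n ** c = 0
  by lincomb (eqD (eqB (eqB (eqMn 3 r5D) r6C) (eqMn 3 r3A)) (eqMn 2 (eqD r2E r3A))).
  by [].
have := relr_ca (C n); rewrite !(tab, lieE) => r2C.
have := relr_ec (C n); rewrite !(tab, lieE) => r3C.
have := relr_da (C n); rewrite !(tab, lieE) => r5C.
have := relr_dc (C n); rewrite !(tab, lieE) => r7C.
have := relr_ec (B n); rewrite !(tab, lieE) => r3B.
have := relr_ca (D n); rewrite !(tab, lieE) => r2D.
move=> g; rewrite !inE => /or4P[/eqP->|/eqP->|/eqP->|/orP[]/eqP->].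
- by lincomb r2C.
- by lincomb (eqB (esym r5C) (eqMn 3 r2D)).
- by lincomb (eqD r3A (eqMn 2 Vc)).
- by lincomb (eqD (esym r7C) (eqMn 3 r3B)).
- by lincomb (esym r3C).
Qed.

(** Since [D k] and [W k] arise from [d] by multiplying with [c], and [c] kills
    [V] and [Z], moving one [c] at a time from the right factor to the left one
    relates [B j ** D k], [B j ** W k], [U j ** W k] and [U j ** D k] in a
    closed recursion.  Only the tables below [N] enter, because the result is
    used to establish the table in degree [2N+1]. *)
Lemma products_below N :
    (forall m, (m < N)%N ->
       [/\ V m ** c = 0, Z m ** c = 0 & B m ** d = Z m - V m]) ->
  forall k j, (j + k < N)%N ->
  [/\ U j ** D k = C (j + k).+1,
      B j ** D k = Z (j + k) *+ k.*2.+1 - V (j + k)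
    & B j ** W k = C (j + k).+1].
Proof.
move=> low.
have BW k j : (j + k < N)%N -> U j ** D k = C (j + k).+1 ->
    B j ** D k = Z (j + k) *+ k.*2.+1 - V (j + k) ->
  B j ** W k = C (j + k).+1.
  move=> /low[Vc Zc _] UD BD.
  rewrite -(D_c sys) lie_lieR BD (B_c sys) !lieE Vc Zc UD mul0rn; zmod.
elim=> [|k IHk] j ltjkN.
  have [_ _ Bd] := low _ ltjkN; rewrite addn0 in Bd.
  have UD : U j ** D 0%N = C (j + 0).+1 by rewrite addn0 (D_0 sys) (U_d sys).
  have BD : B j ** D 0%N = Z (j + 0) *+ 1 - V (j + 0).
    by rewrite addn0 (D_0 sys) Bd.
  by split=> //; apply: BW.
have ltjkN' : (j.+1 + k < N)%N by rewrite addSnnS.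
have [UDj _ BWj] := IHk j (leq_ltn_trans (leq_add (leqnn j) (leqnSn k)) ltjkN).
have [_ BDj1 BWj1] := IHk j.+1 ltjkN'.
have [Vc Zc _] := low _ ltjkN'.
have UW : U j ** W k = Z (j + k).+1 *+ k.*2.+2 - V (j + k).+1.
  rewrite -(D_c sys) lie_lieR UDj (U_c sys) (C_c sys) lieE BDj1 addSn !mulrS; zmod.
have UD : U j ** D k.+1 = C (j + k.+1).+1.
  rewrite -(W_c sys) lie_lieR UW (U_c sys) !lieE -addSn Vc Zc BWj1 addSnnS.
  rewrite mul0rn; zmod.
have BD : B j ** D k.+1 = Z (j + k.+1) *+ k.+1.*2.+1 - V (j + k.+1).
  rewrite -(W_c sys) lie_lieR BWj (B_c sys) (C_c sys) lieE UW addnS doubleS.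
  rewrite !mulrS; zmod.
by split=> //; apply: BW.
Qed.

Definition tables n := [/\ BD_table n, extremal_table n & even_table n].

Lemma tables0 : tables 0.
Proof.
have Z0 : Z 0%N = 0 by rewrite -(C_c sys) (C_0 sys) liexx.
have V0 : V 0%N = d ** b by rewrite -[d](D_0 sys) (D_b sys) Z0 addr0.
have BD0 : BD_table 0.
  split; rewrite ?(B_0 sys) ?(D_0 sys) ?Z0 ?V0.
  - exact: rel_ba rel.
  - by rewrite lie_anti sub0r.
  - by rewrite lie_anti -(D_c sys) (D_0 sys) (rel_dc rel).
  - by rewrite (rel_da rel) lie_anti -[U 0%N]opprK -(B_c sys) (B_0 sys).
  - by rewrite lie_anti (rel_ed rel) oppr0.
have ext0 : extremal_table 0 by split; rewrite ?(B_0 sys) ?(D_0 sys) liexx.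
split=> //; apply: even_of_BD => // [|g _]; last by rewrite Z0 lie0l.
by rewrite V0 (rel_db rel) -relr_ca (rel_ec rel) lie0l.
Qed.

(** An element of the middle degree commutes with itself.  Writing one of its
    two copies as a product with [a] or [e] and expanding turns this into
    [C n.+1 ** a = 0] or [C n.+1 ** e = 0]: for odd [n] the element is [B j]
    or [D j], for even [n] it is [U j] or [W j]. *)
Lemma extremal_of_lower n :
  (forall m, (m <= n)%N -> tables m) -> extremal_table n.+1.
Proof.
move=> low.
have [_ _ wk] : [/\ BD_table n.+1, ACE_table n.+1 & extremal_relations n.+1].
  by case: (low n (leqnn n)) => _ _; apply: odd_of_even.
suff [Ca Ce] : C n.+1 ** a = 0 /\ C n.+1 ** e = 0.
  by split; rewrite -?(Ca_Bb wk) -?(Ce_Dd wk).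
have prods k j : (j + k <= n)%N ->
  U j ** D k = C (j + k).+1 /\ B j ** W k = C (j + k).+1.
  rewrite -ltnS => ltjk.
  have [|UD _ BW] := @products_below n.+1 _ k j ltjk; last by [].
  by move=> m /low[BD _ ev]; rewrite (V_c ev) (Z_c ev) (B_d BD).
have [odd_n|even_n] := boolP (odd n).
  pose i := n./2; pose j := i.+1.
  have nE : n = (j + i)%N by have := odd_double_half n; rewrite odd_n -addnn.
  have [BDj _ _] : tables j by apply: low; rewrite nE leq_addr.
  have [_ _ evi] : tables i by apply: low; rewrite nE leq_addl.
  have [_ BW] : U j ** D i = C n.+1 /\ B j ** W i = C n.+1.
    by rewrite nE; apply: prods; rewrite nE.
  have [UD _] : U i ** D j = C n.+1 /\ B i ** W j = C n.+1.
    by rewrite nE [(j + i)%N]addnC; apply: prods; rewrite nE addnC.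
  split.
    have := lie_lieR (B j) (W i) a.
    by rewrite (W_a evi) lieNr liexx BW (B_a BDj) lie0l subr0 oppr0.
  have := lie_lieR (D j) (U i) e.
  rewrite (U_e evi) liexx (lie_anti (D j) (U i)) UD (D_e BDj) lieNl lie0l => h.
  by lincomb h.
pose j := n./2.
have nE : n = (j + j)%N.
  by have := odd_double_half n; rewrite (negPf even_n) -addnn.
have [BDj _ evj] : tables j by apply: low; rewrite nE leq_addr.
have [UD BW] : U j ** D j = C n.+1 /\ B j ** W j = C n.+1.
  by rewrite nE; apply: prods; rewrite nE.
split.
  have := lie_lieR (U j) (D j) a.
  by rewrite (D_a BDj) liexx UD (U_a evj) lie0l subr0.
have := lie_lieR (W j) (B j) e.
rewrite (B_e BDj) lieNr liexx (lie_anti (W j) (B j)) BW (W_e evj) lieNl lie0l => h.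
by lincomb h.
Qed.

Theorem tables_all n : tables n.
Proof.
elim/ltn_ind: n => -[|n] low; first exact: tables0.
have ext : extremal_table n.+1 by apply: extremal_of_lower.
have [_ _ ev] := low n (ltnSn n).
have [BD ACE wk] := odd_of_even ev.
by split=> //; apply: even_of_odd.
Qed.

(** * Products of higher degree and the torsion *)

Lemma odd_tables n :
  [/\ ACE_table n.+1, C n.+1 ** a = 0 & C n.+1 ** e = 0].
Proof.
have [_ _ ev] := tables_all n; have [_ [Bb Dd] _] := tables_all n.+1.
by have [_ ACE [Ca Ce _ _]] := odd_of_even ev; rewrite Ca Ce.
Qed.

Lemma BD_prod j k : B j ** D k = Z (j + k) *+ k.*2.+1 - V (j + k).
Proof.
have [|_ ->] := @products_below (j + k).+1 _ k j (ltnSn _); last by [].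
by move=> m _; have [BD _ ev] := tables_all m; rewrite (V_c ev) (Z_c ev) (B_d BD).
Qed.

Lemma UD_prod j k : U j ** D k = C (j + k).+1.
Proof.
have [|-> _] := @products_below (j + k).+1 _ k j (ltnSn _); last by [].
by move=> m _; have [BD _ ev] := tables_all m; rewrite (V_c ev) (Z_c ev) (B_d BD).
Qed.

Lemma UW_prod j k : U j ** W k = Z (j + k).+1 *+ k.*2.+2 - V (j + k).+1.
Proof.
rewrite -(D_c sys) lie_lieR UD_prod (U_c sys) (C_c sys) lieE BD_prod addSn !mulrS.
zmod.
Qed.

Lemma DbD_prod j i : D j ** b ** D i = D (j + i).+1.
Proof.
have [_ _ ev] := tables_all j.
elim: i => [|i IHi].
  by rewrite (D_0 sys) (D_b sys) lieDl (V_d ev) (Z_d ev) !addr0 addn0.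
have Dbc : D j ** b ** c = 0 by rewrite (D_b sys) lieDl (V_c ev) (Z_c ev) addr0.
by rewrite -(W_c sys) -(D_c sys) !lie_lieR IHi Dbc !lie0l !subr0 !sysE addnS.
Qed.

Lemma CD_prod j i : C j.+1 ** D i = - (W (j + i).+1 *+ 3).
Proof.
have [ACE Ca Ce] := odd_tables j.
elim: i => [|i IHi]; first by rewrite (D_0 sys) (C_d ACE) addn0.
have [BDi _ evi] := tables_all i; have [_ _ ev] := tables_all (j + i).+1.
have [BD _ _] := tables_all (j + i).+2.
rewrite -(U_e evi) -(D_a BDi) !lie_lieR IHi Ca Ce !lieE (W_a ev) !lieE (B_e BD).
rewrite addnS; zmod.
Qed.

Lemma CU_prod j i : C j.+1 ** U i = B (j + i).+2 *+ 3.
Proof.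
have [_ Ca _] := odd_tables j; have [BDi _ _] := tables_all i.
have [_ _ ev] := tables_all (j + i).+1.
rewrite -(D_a BDi) lie_lieR CD_prod Ca !lieE (W_a ev); zmod.
Qed.

(** [BD_prod] evaluates [b ** D n] with coefficient [2n+1] at [Z n], while
    [D n ** b] has coefficient 1; anticommutativity adds the two. *)
Lemma torsion2 n : Z n *+ n.+1.*2 = 0.
Proof.
have := BD_prod 0 n; rewrite (B_0 sys) lie_anti (D_b sys) add0n => h.
have : Z n *+ n.*2.+1 + Z n = 0 by lincomb (esym h).
by rewrite -mulrSr doubleS.
Qed.

(** For odd [n] the relation is [x ** x = 0] for [x = D j ** b], for even [n] it
    is [x ** x = 0] for [x = C j.+1]; the latter gives only three times the
    relation, which [torsion2] repairs. *)
Lemma torsion n : Z n *+ n.+1 = 0.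
Proof.
have [odd_n|even_n] := boolP (odd n).
  pose j := n./2.
  have nE : n = (j + j).+1 by have := odd_double_half n; rewrite odd_n -addnn.
  have [_ _ ev] := tables_all j.
  have DbD : D j ** b ** D j ** b = V n + Z n by rewrite DbD_prod (D_b sys) nE.
  have DbbD : D j ** b ** b ** D j = - (Z n *+ j.*2.+1 - V n).
    rewrite (D_b sys) lieDl (V_b ev) (Z_b ev) addr0 lieNl BD_prod nE addSn; zmod.
  have := lie_lieR (D j ** b) (D j) b; rewrite liexx DbD DbbD => h.
  have nE' : n = j.*2.+1 by rewrite nE addnn.
  rewrite mulrS {3}nE'; set Zm := (Z n *+ _) in h *; lincomb (esym h).
case: n even_n => [|n] even_n.
  by rewrite -(C_c sys) (C_0 sys) liexx mul0rn.
pose j := n./2.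
have nE : n = (j + j).+1.
  by have := odd_double_half n; move: even_n; rewrite /= negbK -addnn => ->.
have [ACE _ _] := odd_tables j; have [BD _ _] := tables_all (j + j).+2.
have := lie_lieR (C j.+1) (U j) d.
rewrite (U_d sys) liexx CU_prod (C_d ACE) !lieE (lie_anti (W j.+1)) UW_prod.
rewrite (B_d BD) addnS -nE => h.
have YE : Z n.+1 *+ j.+1.*2.+2 = Z n.+1 + Z n.+1 *+ n.+2.
  by rewrite -mulrS doubleS -addnn -nE.
have Y2 : Z n.+1 *+ n.+2 *+ 2 = 0 by rewrite -mulrnA muln2 torsion2.
move: h Y2; rewrite {}YE; move: (_ *+ n.+2) => Y h Y2.
by lincomb (eqB h Y2).
Qed.

End Table.

(** * Lower central factors *)

(** An additive map into [A] that is onto modulo [B] and injective modulo [B]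
    is an isomorphism onto the quotient. *)
Lemma subquotient_isog (V W : zmodType) (A B : zmodClosed V)
    (h : {additive W -> V}) :
    (forall w, h w \in A) ->
    (forall x, x \in A -> exists w, x - h w \in B) ->
    (forall w, h w \in B -> w = 0) ->
  zmod_isog (subquotient A B) W.
Proof.
move=> hA h_surj h_inj.
pose u w : subgroup A := exist _ (h w) (hA w).
pose g w : subquotient A B := \pi_(subquotient A B) (u w).
have gB : {morph g : w w' / w - w'}.
  move=> w w'; rewrite /g -[RHS](raddfB (\pi_(Quotient.quot (@trace V A B)))).
  by congr (\pi _); apply: val_inj; rewrite /= raddfB.
have g_surj q : exists w, g w == q.
  elim/quotW: q => x; have [w Bxw] := h_surj (val x) (valP x).
  exists w; rewrite eq_sym -Quotient.idealrBE.
  by rewrite unfold_in /trace raddfB.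
pose f q := xchoose (g_surj q).
have fK q : g (f q) = q by exact/eqP/(xchooseP (g_surj q)).
have g_inj : injective g.
  move=> w w' /eqP; rewrite -Quotient.idealrBE unfold_in /trace raddfB /= -raddfB.
  by move=> /h_inj/subr0_eq.
have gK w : f (g w) = w by apply: g_inj.
have fB : zmod_morphism f by move=> p q; apply: g_inj; rewrite gB !fK.
pose fA := GRing.isZmodMorphism.Build _ _ f fB.
exists (HB.pack f fA : {additive _ -> _}); by exists g.
Qed.

Section Spanning.
Variable L : lieRingType.
Implicit Types x y z : L.

Lemma lcs_lie i x y : x \in lcs i.+1 -> x ** y \in lcs i.+2.
Proof. by move=> Lx; apply/asboolP/in_zspan_gen; exists x, y. Qed.

Lemma lcs_lie2 i x y :
  x \in lcs i.+1 -> y \in lcs 2 -> x ** y \in lcs i.+3.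
Proof.
move=> Lx /asboolP; elim=> {y} [_ [y [z [_ _ ->]]]||y z _ IHy _ IHz].
- by rewrite lie_lieR rpredB // !lcs_lie.
- by rewrite lie0r rpred0.
- by rewrite lieDr lieNr rpredB.
Qed.

Lemma lcsS i x : x \in lcs i.+1 -> x \in lcs i.
Proof.
case: i => [|i]; first by [].
elim: i x => [|i IHi] x; first by [].
move=> /asboolP; elim=> {x} [_ [x [y [Lx _ ->]]]||x y _ Lx _ Ly].
- exact/lcs_lie/IHi.
- exact: rpred0.
- exact: rpredB.
Qed.

Variable S : nat -> L -> Prop.
Hypothesis S_gen : forall x, exists2 y, in_zspan (S 1) y & x - y \in lcs 2.
Hypothesis S_lie : forall i x g, S i.+1 x -> S 1 g -> in_zspan (S i.+2) (x ** g).

Lemma zspan_lie i x g :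
  in_zspan (S i.+1) x -> in_zspan (S 1) g -> in_zspan (S i.+2) (x ** g).
Proof.
move=> Sx; elim=> {g} [g Sg||g h _ IHg _ IHh].
- elim: Sx => {x} [x Sx||x y _ IHx _ IHy]; first exact: S_lie.
    by rewrite lie0l; apply: in_zspan0.
  by rewrite lieDl lieNl; apply: in_zspanB.
- by rewrite lie0r; apply: in_zspan0.
- by rewrite lieDr lieNr; apply: in_zspanB.
Qed.

(** A spanning set of degree 1, followed by sets that contain its products with
    the degree-1 elements, spans all lower central factors. *)
Lemma lcs_spanned i x : x \in lcs i.+1 ->
  exists2 y, in_zspan (S i.+1) y & x - y \in lcs i.+2.
Proof.
elim: i x => [|i IHi] x; first by move=> _; apply: S_gen.
move=> /asboolP; elim=> {x} [_ [x [y [Lx _ ->]]]||x x' _ [y Sy Lxy] _ [y' Sy' Lxy']].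
- have [x' Sx' Lxx'] := IHi x Lx; have [y' Sy' Lyy'] := S_gen y.
  exists (x' ** y'); first exact: zspan_lie.
  have Lx' : x' \in lcs i.+1 by rewrite -[x'](subKr x) rpredB //; apply: lcsS.
  have -> : x ** y - x' ** y' = (x - x') ** y + x' ** (y - y').
    by rewrite lieDl lieDr lieNl lieNr; zmod.
  by apply: rpredD; [apply: lcs_lie | apply: lcs_lie2].
- by exists 0; [apply: in_zspan0 | rewrite subrr rpred0].
- exists (y - y'); first exact: in_zspanB.
  have -> : x - x' - (y - y') = x - y - (x' - y') by zmod.
  exact: rpredB.
Qed.

End Spanning.

(** * A central extension of 3 x 3 polynomial matrices *)

Section MatrixForms.
Variable R : comNzRingType.
Implicit Types x y z : 'M[R]_3.

Definition comm_mx3 x y : 'M[R]_3 := x *m y - y *m x.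

(** The polarization of the second elementary symmetric function [e2] of the
    eigenvalues.  Like the trace form it is invariant, but it is in addition
    even on the diagonal, as needed for a cocycle modulo an even number. *)
Definition polar_e2 x y : R := \tr x * \tr y - \tr (x *m y).

Lemma comm_mx3Dl x y z : comm_mx3 (x + y) z = comm_mx3 x z + comm_mx3 y z.
Proof. by rewrite /comm_mx3 mulmxDl mulmxDr; zmod. Qed.

Lemma comm_mx3Dr x y z : comm_mx3 x (y + z) = comm_mx3 x y + comm_mx3 x z.
Proof. by rewrite /comm_mx3 mulmxDl mulmxDr; zmod. Qed.

Lemma comm_mx3xx x : comm_mx3 x x = 0.
Proof. exact: subrr. Qed.

Lemma comm_mx3_jacobi x y z :
  comm_mx3 x (comm_mx3 y z) + comm_mx3 y (comm_mx3 z x)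
    + comm_mx3 z (comm_mx3 x y) = 0.
Proof. by rewrite /comm_mx3 !mulmxBl !mulmxBr !mulmxA; zmod. Qed.

Lemma polar_e2Dl x y z : polar_e2 (x + y) z = polar_e2 x z + polar_e2 y z.
Proof. by rewrite /polar_e2 mulmxDl !raddfD /=; ring. Qed.

Lemma polar_e2Dr x y z : polar_e2 x (y + z) = polar_e2 x y + polar_e2 x z.
Proof. by rewrite /polar_e2 mulmxDr !raddfD /=; ring. Qed.

Lemma polar_e2_invariant x y z :
  polar_e2 x (comm_mx3 y z) = polar_e2 z (comm_mx3 x y).
Proof.
rewrite /polar_e2 /comm_mx3 !mulmxBr !raddfB /= (mxtrace_mulC z y).
rewrite (mxtrace_mulC y x) (mxtrace_mulC z) (mulmxA z y) (mxtrace_mulC _ x).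
rewrite -mulmxA; ring.
Qed.

Definition e2 x : R :=
  let minor i j := x i i * x j j - x i j * x j i in
  minor 0 1 + minor 0 2 + minor 1 2.

Lemma big_ord3 (f : 'I_3 -> R) : \sum_i f i = f 0 + f 1 + f 2.
Proof.
rewrite !big_ord_recl big_ord0 addr0 addrA; congr (_ + f _ + f _).
all: exact: val_inj.
Qed.

End MatrixForms.

Section PolynomialMatrices.
Implicit Types x y z : 'M[{poly int}]_3.

Definition deriv_mx x : 'M[{poly int}]_3 := map_mx (@deriv _) x.

Lemma deriv_mxD x y : deriv_mx (x + y) = deriv_mx x + deriv_mx y.
Proof. by apply/matrixP => i j; rewrite !mxE derivD. Qed.

Lemma deriv_mxB x y : deriv_mx (x - y) = deriv_mx x - deriv_mx y.
Proof. by apply/matrixP => i j; rewrite !mxE derivB. Qed.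

Lemma deriv_mxM x y : deriv_mx (x *m y) = deriv_mx x *m y + x *m deriv_mx y.
Proof.
apply/matrixP => i j; rewrite !mxE raddf_sum -big_split; apply: eq_bigr => k _.
by rewrite !mxE /= derivM.
Qed.

Lemma deriv_mx_comm x y :
  deriv_mx (comm_mx3 x y) = comm_mx3 (deriv_mx x) y + comm_mx3 x (deriv_mx y).
Proof. by rewrite /comm_mx3 deriv_mxB !deriv_mxM; zmod. Qed.

Lemma mxtrace_deriv x : \tr (deriv_mx x) = (\tr x)^`().
Proof. by rewrite /mxtrace raddf_sum; apply: eq_bigr => i _; rewrite mxE. Qed.

Lemma deriv_polar_e2 x y :
  (polar_e2 x y)^`() = polar_e2 (deriv_mx x) y + polar_e2 x (deriv_mx y).
Proof.
rewrite /polar_e2 derivB derivM -!mxtrace_deriv deriv_mxM raddfD /=; ring.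
Qed.

(** Half of the derivative of [polar_e2 x x = 2 * e2 x]. *)
Lemma polar_e2_deriv_diag x : polar_e2 (deriv_mx x) x = (e2 x)^`().
Proof.
rewrite /polar_e2 /e2 /mxtrace !big_ord3 !mxE !big_ord3 /deriv_mx !mxE.
rewrite !(derivD, derivN, derivM); ring.
Qed.

(** The coefficient of [t ^ (2N+1)] in the differential form [polar_e2 dx y],
    where [t] is the variable, modulo [2N+2].  For an exact form [dp] this
    coefficient is a multiple of [2N+2], which makes it a 2-cocycle.  On
    matrices of trace 0 it is, up to sign, a quotient of the cocycle of the
    universal central extension, whose values are the differential forms modulo
    the exact ones. *)
Definition cocycle (N : nat) x y : 'Z_(N.+1.*2) :=
  ((polar_e2 (deriv_mx x) y)`_(N.*2.+1))%:~R.

Variable N : nat.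

Lemma cocycleDl x y z : cocycle N (x + y) z = cocycle N x z + cocycle N y z.
Proof. by rewrite /cocycle deriv_mxD polar_e2Dl coefD rmorphD. Qed.

Lemma cocycleDr x y z : cocycle N x (y + z) = cocycle N x y + cocycle N x z.
Proof. by rewrite /cocycle polar_e2Dr coefD rmorphD. Qed.

Lemma deriv_coef_eq0 (p : {poly int}) :
  (p^`()`_(N.*2.+1))%:~R = 0 :> 'Z_(N.+1.*2).
Proof.
have char : N.*2.+2%:R = 0 :> 'Z_(N.+1.*2) by apply: pchar_Zp.
by rewrite coef_deriv rmorphMn /= -mulr_natr char mulr0.
Qed.

Lemma cocycle_xx x : cocycle N x x = 0.
Proof. by rewrite /cocycle polar_e2_deriv_diag deriv_coef_eq0. Qed.

Lemma cocycle_jacobi x y z :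
  cocycle N x (comm_mx3 y z) + cocycle N y (comm_mx3 z x)
    + cocycle N z (comm_mx3 x y) = 0.
Proof.
rewrite -[RHS](deriv_coef_eq0 (polar_e2 x (comm_mx3 y z))) /cocycle -!rmorphD.
rewrite -2!coefD deriv_polar_e2 deriv_mx_comm polar_e2Dr [in RHS]addrA.
rewrite (polar_e2_invariant x (deriv_mx y) z) (polar_e2_invariant z x).
by rewrite (polar_e2_invariant x y (deriv_mx z)).
Qed.

End PolynomialMatrices.

Section Model.
Variable N : nat.

Definition model : Type := ('M[{poly int}]_3 * 'Z_(N.+1.*2))%type.
HB.instance Definition _ := GRing.Zmodule.on model.

Definition model_lie (x y : model) : model :=
  (comm_mx3 x.1 y.1, cocycle N x.1 y.1).

Lemma model_lieDl (x y z : model) :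
  model_lie (x + y) z = model_lie x z + model_lie y z.
Proof. by rewrite /model_lie comm_mx3Dl cocycleDl. Qed.

Lemma model_lieDr (x y z : model) :
  model_lie x (y + z) = model_lie x y + model_lie x z.
Proof. by rewrite /model_lie comm_mx3Dr cocycleDr. Qed.

Lemma model_liexx (x : model) : model_lie x x = 0.
Proof. by rewrite /model_lie comm_mx3xx cocycle_xx. Qed.

Lemma model_lie_jacobi (x y z : model) :
  model_lie x (model_lie y z) + model_lie y (model_lie z x)
    + model_lie z (model_lie x y) = 0.
Proof.
apply: injective_projections; [exact: comm_mx3_jacobi | exact: cocycle_jacobi].
Qed.

HB.instance Definition _ := Zmodule_isLieRing.Build model
  model_lieDl model_lieDr model_liexx model_lie_jacobi.

Definition homog (i : nat) (m : 'M[int]_3) : 'M[{poly int}]_3 :=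
  'X^i *: map_mx polyC m.

Lemma homog_eq0 i m (p : 'M[{poly int}]_3) : 'X^(i.+1) *: p = homog i m -> m = 0.
Proof.
move/matrixP=> E; apply/matrixP => r s; have := E r s.
rewrite !mxE => /(congr1 (fun q : {poly int} => q`_i)).
by rewrite !coefXnM ltnn subnn ltnSn coefC eqxx => <-.
Qed.

Lemma comm_homog i j m p :
  comm_mx3 (homog i m) (homog j p) = homog (i + j) (comm_mx3 m p).
Proof.
rewrite /comm_mx3 /homog -!scalemxAl -!scalemxAr !scalerA -!exprD [(j + i)%N]addnC.
by rewrite map_mxB !map_mxM scalerBr.
Qed.

Lemma cocycle_homog i j m p :
  cocycle N (homog i.+1 m) (homog j p) =
  if (i + j == N.*2.+1)%N then (polar_e2 m p *+ i.+1)%:~R else 0.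
Proof.
rewrite /cocycle.
have -> : deriv_mx (homog i.+1 m) = (i.+1%:R * 'X^i) *: map_mx polyC m.
  apply/matrixP => r s; rewrite !mxE derivM derivC mulr0 addr0 derivXn /=.
  by rewrite mulr_natl.
have -> : polar_e2 ((i.+1%:R * 'X^i) *: map_mx polyC m) (homog j p) =
    (polar_e2 m p *+ i.+1)%:P * 'X^(i + j).
  rewrite /polar_e2 /homog -scalemxAl -scalemxAr !mxtraceZ -map_mxM.
  rewrite !trace_map_mx polyCMn polyCB polyCM exprD -mulr_natl; ring.
by rewrite coefCM coefXn eq_sym; case: eqP => _; rewrite ?mulr1 ?mulr0.
Qed.

(** The elements of degree at least [i]; the central part has degree [2N+2]. *)
Definition filt (i : nat) (x : model) : Prop :=
  (exists m : 'M[{poly int}]_3, x.1 = 'X^i *: m) /\ ((N.*2.+2 < i)%N -> x.2 = 0).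

Lemma filtB i x y : filt i x -> filt i y -> filt i (x - y).
Proof.
move=> [[m xm] x2] [[p yp] y2]; split=> [|ltNi].
  by exists (m - p); rewrite /= xm yp scalerBr.
by rewrite /= x2 // y2 // subrr.
Qed.

Lemma filt0 i : filt i 0.
Proof. by split=> //; exists 0; rewrite scaler0. Qed.

Lemma filtS i x : filt i.+1 x -> filt i x.
Proof.
move=> [[m xm] x2]; split=> [|ltNi]; last exact/x2/ltnW.
by exists ('X *: m); rewrite scalerA -exprSr.
Qed.

Lemma filt_lie i j x y :
  filt i.+1 x -> filt j.+1 y -> filt (i.+1 + j.+1) (x ** y).
Proof.
move=> [[m xm] _] [[p yp] _]; split=> [|ltNi] /=.
  exists (comm_mx3 m p); rewrite xm yp /comm_mx3 -!scalemxAl -!scalemxAr !scalerA.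
  by rewrite -!exprD [(j.+1 + i.+1)%N]addnC scalerBr.
have [q xq] : exists q : 'M[{poly int}]_3, 'X^i *: q = deriv_mx x.1.
  exists (i.+1%:R *: m + 'X *: deriv_mx m); rewrite xm; apply/matrixP => r s.
  rewrite !mxE derivM derivXn /= -mulr_natl exprS; ring.
have polarE : polar_e2 (deriv_mx x.1) y.1 = 'X^(i + j.+1) * polar_e2 q p.
  by rewrite yp -xq /polar_e2 -scalemxAl -scalemxAr !mxtraceZ exprD; ring.
by rewrite /cocycle polarE coefXnM ifT //; lia.
Qed.

Definition homog_el (i : nat) (m : 'M[int]_3) : model := (homog i m, 0).

Lemma lie_el i m p :
  homog_el i.+1 m ** homog_el 1 p = (homog i.+2 (comm_mx3 m p),
    if i == N.*2 then (polar_e2 m p *+ i.+1)%:~R else 0).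
Proof.
rewrite /lie /= /model_lie /homog_el /= comm_homog cocycle_homog addn1 addn1 eqSS.
by [].
Qed.

Definition mx3 (s : seq (seq int)) : 'M[int]_3 :=
  \matrix_(i, j) (nth [::] s i)`_j.

(** Modulo scalar matrices [ma], ..., [me] span the 5-dimensional irreducible
    module of the copy of [so_3] spanned by [mu], [mv] and [mw].  The matrix
    [mk] is [3 mc] plus the identity, which has trace 0. *)
Definition ma := mx3 [:: [:: 0; 0; 1]; [:: 0; 0; 0]; [:: 0; 0; 0]].
Definition mb := mx3 [:: [:: 0; 1; 0]; [:: 0; 0; -1]; [:: 0; 0; 0]].
Definition mc := mx3 [:: [:: 0; 0; 0]; [:: 0; -1; 0]; [:: 0; 0; 0]].
Definition md := mx3 [:: [:: 0; 0; 0]; [:: 1; 0; 0]; [:: 0; -1; 0]].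
Definition me := mx3 [:: [:: 0; 0; 0]; [:: 0; 0; 0]; [:: 1; 0; 0]].
Definition mu := mx3 [:: [:: 0; 1; 0]; [:: 0; 0; 1]; [:: 0; 0; 0]].
Definition mv := mx3 [:: [:: -1; 0; 0]; [:: 0; 0; 0]; [:: 0; 0; 1]].
Definition mw := mx3 [:: [:: 0; 0; 0]; [:: 1; 0; 0]; [:: 0; 1; 0]].
Definition mk := mx3 [:: [:: 1; 0; 0]; [:: 0; -2; 0]; [:: 0; 0; 1]].

Ltac mx3_comm :=
  apply/matrixP => -[[|[|[|?]]] ?] -[[|[|[|?]]] ?] //;
  rewrite !mxE !big_ord3 !mxE //=.

Lemma comm_bc : comm_mx3 mb mc = - mu. Proof. mx3_comm. Qed.
Lemma comm_dc : comm_mx3 md mc = mw. Proof. mx3_comm. Qed.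
Lemma comm_uc : comm_mx3 mu mc = - mb. Proof. mx3_comm. Qed.
Lemma comm_wc : comm_mx3 mw mc = md. Proof. mx3_comm. Qed.
Lemma comm_ub : comm_mx3 mu mb = - (ma *+ 2). Proof. mx3_comm. Qed.
Lemma comm_ud : comm_mx3 mu md = mk. Proof. mx3_comm. Qed.
Lemma comm_wd : comm_mx3 mw md = me *+ 2. Proof. mx3_comm. Qed.
Lemma comm_kc : comm_mx3 mk mc = 0. Proof. mx3_comm. Qed.
Lemma comm_db : comm_mx3 md mb = mv. Proof. mx3_comm. Qed.
Lemma comm_ba : comm_mx3 mb ma = 0. Proof. mx3_comm. Qed.
Lemma comm_ca : comm_mx3 mc ma = 0. Proof. mx3_comm. Qed.
Lemma comm_ec : comm_mx3 me mc = 0. Proof. mx3_comm. Qed.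
Lemma comm_ed : comm_mx3 me md = 0. Proof. mx3_comm. Qed.
Lemma comm_da : comm_mx3 md ma = mu. Proof. mx3_comm. Qed.
Lemma comm_cb : comm_mx3 mc mb = mu. Proof. mx3_comm. Qed.
Lemma comm_ea : comm_mx3 me ma = mv. Proof. mx3_comm. Qed.
Lemma comm_eb : comm_mx3 me mb = mw. Proof. mx3_comm. Qed.

Lemma polar_bc : polar_e2 mb mc = 0.
Proof. by rewrite /polar_e2 /mxtrace !big_ord3 !mxE !big_ord3 !mxE. Qed.
Lemma polar_dc : polar_e2 md mc = 0.
Proof. by rewrite /polar_e2 /mxtrace !big_ord3 !mxE !big_ord3 !mxE. Qed.
Lemma polar_kc : polar_e2 mk mc = -2.
Proof. by rewrite /polar_e2 /mxtrace !big_ord3 !mxE !big_ord3 !mxE. Qed.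
Lemma polar_db : polar_e2 md mb = -2.
Proof. by rewrite /polar_e2 /mxtrace !big_ord3 !mxE !big_ord3 !mxE. Qed.

End Model.

(** * The table in the model *)

Section ModelTable.
Variable N : nat.
Local Notation homog_el := (@homog_el N).

Lemma el_lie0 i m p : i != N.*2 ->
  homog_el i.+1 m ** homog_el 1 p = homog_el i.+2 (comm_mx3 m p).
Proof. by move=> iN; rewrite lie_el (negPf iN). Qed.

Lemma el_lie_polar0 i m p : polar_e2 m p = 0 ->
  homog_el i.+1 m ** homog_el 1 p = homog_el i.+2 (comm_mx3 m p).
Proof. by move=> mp0; rewrite lie_el mp0 mul0rn if_same. Qed.

Lemma homogN i m : homog i (- m) = - homog i m.
Proof. by rewrite /homog map_mxN scalerN. Qed.

Lemma elN i m : homog_el i (- m) = - homog_el i m.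
Proof. by apply: injective_projections; rewrite /= ?homogN ?oppr0. Qed.

Lemma homog0 i : homog i 0 = 0.
Proof. by rewrite /homog map_mx0 scaler0. Qed.

Hypothesis N_gt0 : (0 < N)%N.

(** Both sides of the relations have degree 2, where the cocycle vanishes
    for positive [N]. *)
Lemma model_relations :
  seven_relations (homog_el 1 ma) (homog_el 1 mb) (homog_el 1 mc)
    (homog_el 1 md) (homog_el 1 me).
Proof.
have N2 : 0%N != N.*2 by rewrite eq_sym double_eq0 -lt0n.
have el0 m : m = 0 -> homog_el 2 m = 0 by move=> ->; rewrite /homog_el homog0.
split; rewrite !(el_lie0 _ _ N2) ?comm_da ?comm_cb ?comm_db ?comm_ea ?comm_dc ?comm_eb.
- exact/el0/comm_ba.
- exact/el0/comm_ca.
- exact/el0/comm_ec.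
- exact/el0/comm_ed.
all: by [].
Qed.

Variables A B C D E U V W Z : nat -> model N.
Hypothesis sys : table_system (homog_el 1 ma) (homog_el 1 mb) (homog_el 1 mc)
  (homog_el 1 md) (homog_el 1 me) A B C D E U V W Z.

Lemma el_bc i : homog_el i.+1 mb ** homog_el 1 mc = - homog_el i.+2 mu.
Proof. by rewrite (el_lie_polar0 _ polar_bc) comm_bc elN. Qed.

Lemma el_dc i : homog_el i.+1 md ** homog_el 1 mc = homog_el i.+2 mw.
Proof. by rewrite (el_lie_polar0 _ polar_dc) comm_dc. Qed.

Lemma el_even n m p :
  homog_el n.*2.+2 m ** homog_el 1 p = homog_el n.+1.*2.+1 (comm_mx3 m p).
Proof. by rewrite el_lie0 //; apply/eqP; lia. Qed.

Lemma model_BD n : B n = homog_el n.*2.+1 mb /\ D n = homog_el n.*2.+1 md.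
Proof.
elim: n => [|n [IHB IHD]]; first by rewrite (B_0 sys) (D_0 sys).
rewrite -[B n.+1]opprK -(U_c sys) -[U n]opprK -(B_c sys) IHB el_bc opprK.
by rewrite -(W_c sys) -(D_c sys) IHD el_dc !el_even comm_uc comm_wc elN opprK.
Qed.

Lemma model_UW n : U n = homog_el n.*2.+2 mu /\ W n = homog_el n.*2.+2 mw.
Proof.
have [BE DE] := model_BD n.
by rewrite -[U n]opprK -(B_c sys) -(D_c sys) BE DE el_bc el_dc opprK.
Qed.

Lemma model_ACE n :
  [/\ A n.+1 = homog_el n.+1.*2.+1 (ma *+ 2), C n.+1 = homog_el n.+1.*2.+1 mk
    & E n.+1 = homog_el n.+1.*2.+1 (me *+ 2)].
Proof.
have [UE WE] := model_UW n.
rewrite -[A n.+1]opprK -(U_b sys) -(U_d sys) -(W_d sys) UE WE !el_even.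
by rewrite comm_ub comm_ud comm_wd elN opprK.
Qed.

Definition z_value n : 'Z_(N.+1.*2) := if n == N then 2%:R else 0.

(** The value [-2 (2N+1)] of the cocycle at [C N] and [c]. *)
Lemma z_valueE : (- 2 *+ N.*2.+1)%:~R = 2%:R :> 'Z_(N.+1.*2).
Proof.
have char : N.*2.+2%:R = 0 :> 'Z_(N.+1.*2) by apply: pchar_Zp.
(* -2 (2N+1) = 2 - 2 (2N+2) *)
transitivity (2%:R - 2%:R * N.*2.+2%:R : 'Z_(N.+1.*2)).
  by rewrite rmorphMn rmorphN /= rmorph_nat -mulr_natr -[in RHS]natr1; ring.
by rewrite char mulr0 subr0.
Qed.

Lemma model_Z n : Z n = (0, z_value n).
Proof.
rewrite -(C_c sys); case: n => [|n].
  by rewrite (C_0 sys) liexx /z_value eq_sym gtn_eqF.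
have [_ -> _] := model_ACE n.
rewrite lie_el comm_kc homog0 polar_kc /z_value (inj_eq double_inj).
by case: eqP => // ->; rewrite z_valueE.
Qed.

Lemma model_V n : V n = homog_el n.*2.+2 mv.
Proof.
have := D_b sys n; have [_ ->] := model_BD n; rewrite model_Z lie_el comm_db => VE.
rewrite -[V n](addrK (0, z_value n)) -VE; apply: injective_projections => /=.
  by rewrite subr0.
rewrite polar_db (inj_eq double_inj) /z_value.
by case: eqP => [->|_]; rewrite ?z_valueE subrr.
Qed.

End ModelTable.

(** * Graded spanning sets *)

Lemma table_system_exists (L : lieRingType) (a b c d e : L) :
  exists A B C D E U V W Z, table_system a b c d e A B C D E U V W Z.
Proof.
pose B n := iter n (fun x => x ** c ** c) b.
pose D n := iter n (fun x => x ** c ** c) d.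
pose U n := - (B n ** c).
pose W n := D n ** c.
pose A n := if n is m.+1 then - (U m ** b) else a.
pose C n := if n is m.+1 then U m ** d else c.
pose E n := if n is m.+1 then W m ** d else e.
pose Z n := C n ** c.
pose V n := D n ** b - Z n.
exists A, B, C, D, E, U, V, W, Z; split=> // n; rewrite ?opprK ?subrK //.
by rewrite lieNl.
Qed.

Lemma table_system_map (L M : lieRingType) (f : {additive L -> M})
    (f_lie : forall x y, f (x ** y) = f x ** f y)
    (a b c d e : L) (A B C D E U V W Z : nat -> L) :
  table_system a b c d e A B C D E U V W Z ->
  table_system (f a) (f b) (f c) (f d) (f e) (f \o A) (f \o B) (f \o C) (f \o D)
    (f \o E) (f \o U) (f \o V) (f \o W) (f \o Z).
Proof.
case=> A0 B0 C0 D0 E0 Ub Uc Ud Wc Wd Bc Cc Db Dc.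
split=> [|||||n|n|n|n|n|n|n|n|n] /=; rewrite ?A0 ?B0 ?C0 ?D0 ?E0 //.
all: rewrite -f_lie ?Ub ?Uc ?Ud ?Wc ?Wd ?Bc ?Cc ?Db ?Dc ?raddfN ?raddfD; done.
Qed.

HB.instance Definition _ (V : zmodType) (S : V -> Prop) :=
  GRing.isZmodClosed.Build V (zspan S) (zspan_zmod_closed S).

Lemma mulrn_ordB (M : zmodType) (z : M) p (i j : 'I_p.+1) : z *+ p.+1 = 0 ->
  z *+ nat_of_ord (i - j)%R = z *+ i - z *+ j.
Proof.
move=> zp.
have modE m : z *+ (m %% p.+1) = z *+ m.
  by rewrite [in RHS](divn_eq m p.+1) mulrnDr mulnC mulrnA zp mul0rn add0r.
rewrite /= !modE mulrnDr modE mulrnBr ?zp ?sub0r //; exact/ltnW/ltn_ord.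
Qed.

Lemma mem_zspan (V : zmodType) (S : V -> Prop) x : S x -> x \in zspan S.
Proof. by move=> Sx; apply/asboolP/in_zspan_gen. Qed.

Section GradedBasis.
Variables (L : lieRingType) (a b c d e : L) (A B C D E U V W Z : nat -> L).
Hypothesis rel : seven_relations a b c d e.
Hypothesis sys : table_system a b c d e A B C D E U V W Z.

(** The spanning set in degree [i.+1]: [i./2] is the index of the families both
    for degree [2n+1] and for degree [2n+2]. *)
Definition graded_gens i : seq L :=
  if odd i then [:: Z i./2; U i./2; V i./2; W i./2]
  else [:: A i./2; B i./2; C i./2; D i./2; E i./2].

Lemma even_lie_span n x g :
  x \in [:: Z n; U n; V n; W n] -> g \in [:: a; b; c; d; e] ->
  x ** g \in zspan (fun y => y \in [:: A n.+1; B n.+1; C n.+1; D n.+1; E n.+1]).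
Proof.
set S := zspan _.
have SA : A n.+1 \in S by apply: mem_zspan; rewrite /= !inE eqxx ?orbT.
have SB : B n.+1 \in S by apply: mem_zspan; rewrite /= !inE eqxx ?orbT.
have SC : C n.+1 \in S by apply: mem_zspan; rewrite /= !inE eqxx ?orbT.
have SD : D n.+1 \in S by apply: mem_zspan; rewrite /= !inE eqxx ?orbT.
have SE : E n.+1 \in S by apply: mem_zspan; rewrite /= !inE eqxx ?orbT.
have [_ _ []] := tables_all rel sys n => Ua Ue Va Vb Vc Vd Ve Wa Wb We Za Zb Zc Zd Ze.
rewrite !inE => /or4P[]/eqP-> /or4P[/eqP->|/eqP->|/eqP->|/orP[]/eqP->];
  rewrite ?(sysE sys, Ua, Ue, Va, Vb, Vc, Vd, Ve, Wa, Wb, We, Za, Zb, Zc, Zd, Ze);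
  by rewrite ?rpredN ?rpred0.
Qed.

Lemma odd_lie_span n x g :
  x \in [:: A n; B n; C n; D n; E n] -> g \in [:: a; b; c; d; e] ->
  x ** g \in zspan (fun y => y \in [:: Z n; U n; V n; W n]).
Proof.
set S := zspan _.
have SZ : Z n \in S by apply: mem_zspan; rewrite /= !inE eqxx ?orbT.
have SU : U n \in S by apply: mem_zspan; rewrite /= !inE eqxx ?orbT.
have SV : V n \in S by apply: mem_zspan; rewrite /= !inE eqxx ?orbT.
have SW : W n \in S by apply: mem_zspan; rewrite /= !inE eqxx ?orbT.
have [[Ba Bd Be Da De] [Bb Dd] _] := tables_all rel sys n.
have [SA SC SE] : [/\ {in [:: a; b; c; d; e], forall g, A n ** g \in S},
    {in [:: a; b; c; d; e], forall g, C n ** g \in S}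
    & {in [:: a; b; c; d; e], forall g, E n ** g \in S}].
  case: n @S SZ SU SV SW Ba Bd Be Da De Bb Dd
    => [|n] S SZ SU SV SW Ba Bd Be Da De Bb Dd.
    (* The exceptional rows of degree 1, up to signs entries of the others. *)
    rewrite (A_0 sys) (C_0 sys) (E_0 sys).
    rewrite (B_0 sys) in Ba Bb Bd Be; rewrite (D_0 sys) in Da Dd De.
    have cc : c ** c = Z 0%N by rewrite -(C_c sys) (C_0 sys).
    have db : d ** b = V 0%N + Z 0%N by rewrite -(D_b sys) (D_0 sys).
    have dc : d ** c = W 0%N by rewrite -(D_c sys) (D_0 sys).
    have cb : c ** b = U 0%N by rewrite -(rel_da rel).
    have ea : e ** a = V 0%N + Z 0%N by rewrite -(rel_db rel).
    have eb : e ** b = W 0%N by rewrite -(rel_dc rel).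
    have ab : a ** b = 0 by rewrite lie_anti (rel_ba rel) oppr0.
    have ac : a ** c = 0 by rewrite lie_anti (rel_ca rel) oppr0.
    have ad : a ** d = - U 0%N by rewrite lie_anti Da.
    have ae : a ** e = - (V 0%N + Z 0%N) by rewrite lie_anti ea.
    have cd : c ** d = - W 0%N by rewrite lie_anti dc.
    have ce : c ** e = 0 by rewrite lie_anti (rel_ec rel) oppr0.
    split=> y; rewrite !inE => /or4P[/eqP->|/eqP->|/eqP->|/orP[]/eqP->];
      rewrite ?(rel_ca rel, rel_ec rel, rel_ed rel, cc, db, dc, cb, ea, eb);
      by rewrite ?(ab, ac, ad, ae, cd, ce, liexx, rpred0, rpredN, rpredD).
  have [[Aa Ab Ac Ad Ae Cb Cd Ea Eb Ec Ed Ee] Ca Ce] := odd_tables rel sys n.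
  split=> y; rewrite !inE => /or4P[/eqP->|/eqP->|/eqP->|/orP[]/eqP->];
    rewrite ?(Aa, Ab, Ac, Ad, Ae, Ca, Cb, Cd, Ce, Ea, Eb, Ec, Ed, Ee);
    by rewrite ?(C_c sys, rpred0, rpredN, rpredD, rpredMn).
move=> Sx gens; move: Sx; rewrite !inE => /or4P[/eqP->|/eqP->|/eqP->|/orP[]/eqP->].
- exact: SA.
- move: gens; rewrite !inE => /or4P[/eqP->|/eqP->|/eqP->|/orP[]/eqP->];
    rewrite ?(sysE sys, Ba, Bb, Bd, Be);
    by rewrite ?(rpred0, rpredN, rpredB).
- exact: SC.
- move: gens; rewrite !inE => /or4P[/eqP->|/eqP->|/eqP->|/orP[]/eqP->];
    rewrite ?(sysE sys, Da, Dd, De);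
    by rewrite ?(rpred0, rpredN, rpredD).
- exact: SE.
Qed.

Definition graded_span i : L -> Prop := fun x => x \in graded_gens i.-1.

Lemma graded_span_lie i x g :
  graded_span i.+1 x -> graded_span 1 g -> in_zspan (graded_span i.+2) (x ** g).
Proof.
rewrite /graded_span /= /graded_gens /= uphalf_half.
rewrite (A_0 sys) (B_0 sys) (C_0 sys) (D_0 sys) (E_0 sys).
case: (odd i) => /= Sx Sg; apply/asboolP.
  exact: even_lie_span.
exact: odd_lie_span.
Qed.

Lemma graded_gens_lcs i x : x \in graded_gens i -> x \in lcs i.+1.
Proof.
suff basis n : {subset [:: A n; B n; C n; D n; E n] <= lcs n.*2.+1}
    /\ {subset [:: Z n; U n; V n; W n] <= lcs n.*2.+2}.
  rewrite /graded_gens; have [Sodd Sev] := basis i./2.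
  have := odd_double_half i; case: (odd i) => /=; rewrite ?add1n ?add0n => iE.
    by move/Sev; rewrite iE.
  by move/Sodd; rewrite iE.
have even_of n1 : {subset [:: A n1; B n1; C n1; D n1; E n1] <= lcs n1.*2.+1} ->
    {subset [:: Z n1; U n1; V n1; W n1] <= lcs n1.*2.+2}.
  move=> low.
  have Zn : Z n1 \in lcs n1.*2.+2.
    by rewrite -(C_c sys); apply/lcs_lie/low; rewrite !inE eqxx ?orbT.
  move=> y; rewrite !inE => /or4P[]/eqP-> //.
  - rewrite -[U n1]opprK -(B_c sys) rpredN.
    by apply/lcs_lie/low; rewrite !inE eqxx ?orbT.
  - rewrite -[V n1](addrK (Z n1)) -(D_b sys) rpredB //.
    by apply/lcs_lie/low; rewrite !inE eqxx ?orbT.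
  - by rewrite -(D_c sys); apply/lcs_lie/low; rewrite !inE eqxx ?orbT.
suff low : {subset [:: A n; B n; C n; D n; E n] <= lcs n.*2.+1}.
  by split; last exact: even_of.
elim: n => [|n /even_of IHn]; first by move=> y _.
have LU : U n \in lcs n.*2.+2 by apply: IHn; rewrite !inE eqxx ?orbT.
have LW : W n \in lcs n.*2.+2 by apply: IHn; rewrite !inE eqxx ?orbT.
move=> y; rewrite !inE => /or4P[/eqP->|/eqP->|/eqP->|/orP[]/eqP->].
- by rewrite -[A _]opprK -(U_b sys) rpredN lcs_lie.
- by rewrite -[B _]opprK -(U_c sys) rpredN lcs_lie.
- by rewrite -(U_d sys) lcs_lie.
- by rewrite -(W_c sys) lcs_lie.
- by rewrite -(W_d sys) lcs_lie.
Qed.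

Definition odd_comb n (w : int * int * int * int * int) : L :=
  A n *~ w.1.1.1.1 + B n *~ w.1.1.1.2 + C n *~ w.1.1.2 + D n *~ w.1.2 + E n *~ w.2.

Lemma odd_combB n : zmod_morphism (odd_comb n).
Proof. by move=> w w'; rewrite /odd_comb /= !mulrzBr; zmod. Qed.

Definition even_comb n (w : cyclic_zmod n.+1 * int * int * int) : L :=
  Z n *+ (w.1.1.1 : 'I_n.+1) + U n *~ w.1.1.2 + V n *~ w.1.2 + W n *~ w.2.

Lemma even_combB n : zmod_morphism (@even_comb n).
Proof.
move=> w w'; rewrite /even_comb /= !mulrzBr.
have := mulrn_ordB (w.1.1.1 : 'I_n.+1) (w'.1.1.1 : 'I_n.+1) (torsion rel sys n).
move=> /= ->; zmod.
Qed.

Definition even_comb_additive n : {additive _ -> L} :=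
  HB.pack (@even_comb n) (GRing.isZmodMorphism.Build _ _ (@even_comb n) (@even_combB n)).

Definition odd_comb_additive n : {additive _ -> L} :=
  HB.pack (odd_comb n) (GRing.isZmodMorphism.Build _ _ (odd_comb n) (odd_combB n)).

Lemma in_zspan_image (G : zmodType) (f : {additive G -> L}) (S : L -> Prop) x :
  (forall y, S y -> exists w, f w = y) -> in_zspan S x -> exists w, f w = x.
Proof.
move=> Sf; elim=> {x} [x /Sf //||x y _ [v <-] _ [w <-]].
  by exists 0; rewrite raddf0.
by exists (v - w); rewrite raddfB.
Qed.

Lemma odd_comb_surj n x :
  in_zspan (graded_span n.*2.+1) x -> exists w, odd_comb n w = x.
Proof.
apply: (in_zspan_image (f := odd_comb_additive n)) => y.
rewrite /graded_span /graded_gens /= odd_double doubleK !inE.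
move=> /or4P[/eqP->|/eqP->|/eqP->|/orP[]/eqP->].
- by exists (1, 0, 0, 0, 0); rewrite /odd_comb /= !mulr0z ?addr0 ?add0r.
- by exists (0, 1, 0, 0, 0); rewrite /odd_comb /= !mulr0z ?addr0 ?add0r.
- by exists (0, 0, 1, 0, 0); rewrite /odd_comb /= !mulr0z ?addr0 ?add0r.
- by exists (0, 0, 0, 1, 0); rewrite /odd_comb /= !mulr0z ?addr0 ?add0r.
- by exists (0, 0, 0, 0, 1); rewrite /odd_comb /= !mulr0z ?addr0 ?add0r.
Qed.

Lemma even_comb_surj n x :
  in_zspan (graded_span n.*2.+2) x -> exists w, @even_comb n w = x.
Proof.
apply: (in_zspan_image (f := even_comb_additive n)) => y.
rewrite /graded_span /graded_gens /= odd_double uphalf_double !inE.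
move=> /or4P[]/eqP->.
(* In degree 2 the cyclic group is trivial, and so is Z 0. *)
- exists (inord (1 %% n.+1) : 'I_n.+1, 0, 0, 0).
  rewrite /even_comb /= !mulr0z !addr0 inordK ?ltn_pmod //.
  by case: n => [|n] //; rewrite modnn mulr0n -(C_c sys) (C_0 sys) liexx.
- by exists (0, 1, 0, 0); rewrite /even_comb /= mulr0n !mulr0z ?addr0 ?add0r.
- by exists (0, 0, 1, 0); rewrite /even_comb /= mulr0n !mulr0z ?addr0 ?add0r.
- by exists (0, 0, 0, 1); rewrite /even_comb /= mulr0n !mulr0z ?addr0 ?add0r.
Qed.

Lemma odd_comb_lcs n w : odd_comb n w \in lcs n.*2.+1.
Proof.
have basis x : x \in [:: A n; B n; C n; D n; E n] -> x \in lcs n.*2.+1.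
  move=> Sx; apply: graded_gens_lcs.
  by rewrite /graded_gens odd_double doubleK.
by rewrite /odd_comb !rpredD // rpredMz // basis // !inE eqxx ?orbT.
Qed.

Lemma even_comb_lcs n w : @even_comb n w \in lcs n.*2.+2.
Proof.
have basis x : x \in [:: Z n; U n; V n; W n] -> x \in lcs n.*2.+2.
  move=> Sx; apply: graded_gens_lcs.
  by rewrite /graded_gens /= odd_double uphalf_double.
by rewrite /even_comb !rpredD // ?rpredMz ?rpredMn // basis // !inE eqxx ?orbT.
Qed.

End GradedBasis.

(** * The lower central factors of the Lie ring *)

Section Lie57.
Let a : Lie57 := pgen rels7 ga.
Let b : Lie57 := pgen rels7 gb.
Let c : Lie57 := pgen rels7 gc.
Let d : Lie57 := pgen rels7 gd.
Let e : Lie57 := pgen rels7 ge.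

Lemma Lie57_relations : seven_relations a b c d e.
Proof.
pose r s t := @pgen_rels _ rels7 s t.
split.
- by apply: (r (TLie (TGen gb) (TGen ga)) TZero); rewrite !inE eqxx ?orbT.
- by apply: (r (TLie (TGen gc) (TGen ga)) TZero); rewrite !inE eqxx ?orbT.
- by apply: (r (TLie (TGen ge) (TGen gc)) TZero); rewrite !inE eqxx ?orbT.
- by apply: (r (TLie (TGen ge) (TGen gd)) TZero); rewrite !inE eqxx ?orbT.
- by apply: (r (TLie (TGen gd) (TGen ga)) (TLie (TGen gc) (TGen gb)));
    rewrite !inE eqxx ?orbT.
- by apply: (r (TLie (TGen gd) (TGen gb)) (TLie (TGen ge) (TGen ga)));
    rewrite !inE eqxx ?orbT.
- by apply: (r (TLie (TGen gd) (TGen gc)) (TLie (TGen ge) (TGen gb)));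
    rewrite !inE eqxx ?orbT.
Qed.

Lemma Lie57_ind (P : Lie57 -> Prop) :
    P a -> P b -> P c -> P d -> P e -> P 0 ->
    (forall x y, P x -> P y -> P (x - y)) ->
    (forall x y, P x -> P y -> P (x ** y)) ->
  forall x, P x.
Proof.
move=> Pa Pb Pc Pd Pe P0 PB Plie x.
have PN y : P y -> P (- y) by rewrite -sub0r; apply: PB.
elim/quotW: x => t; rewrite -lie_eval_pgen.
elim: t => [[]||s IHs|s IHs t IHt|s IHs t IHt] //=; first exact: PN.
  by rewrite -[X in _ + X]opprK; apply/PB/PN.
exact: Plie.
Qed.

Lemma Lie57_span x (gens : Lie57 -> Prop) :
  (forall y, y \in [:: a; b; c; d; e] -> gens y) ->
  exists2 y, in_zspan gens y & x - y \in lcs 2.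
Proof.
move=> gensP.
have gen y : y \in [:: a; b; c; d; e] ->
    exists2 y', in_zspan gens y' & y - y' \in lcs 2.
  by exists y; [apply/in_zspan_gen/gensP | rewrite subrr rpred0].
elim/Lie57_ind: x => [|||||||x y _ _].
1-5: by apply: gen; rewrite !inE eqxx ?orbT.
- by exists 0; [apply: in_zspan0 | rewrite subrr rpred0].
- move=> x y [x' Sx Lx] [y' Sy Ly]; exists (x' - y'); first exact: in_zspanB.
  have -> : x - y - (x' - y') = x - x' - (y - y') by zmod.
  exact: rpredB.
- exists 0; first exact: in_zspan0.
  by rewrite subr0; apply: (@lcs_lie _ 0).
Qed.

Section ToModel.
Variable N : nat.
Hypothesis N_gt0 : (0 < N)%N.

Definition gen_image (g : gen5) : model N :=
  match g with
  | ga => homog_el N 1 ma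
  | gb => homog_el N 1 mb
  | gc => homog_el N 1 mc
  | gd => homog_el N 1 md
  | ge => homog_el N 1 me
  end.

Lemma to_model : exists f : {additive Lie57 -> model N},
  (forall x y, f (x ** y) = f x ** f y) /\
  (forall g, f (pgen rels7 g) = gen_image g).
Proof.
have [ba ca ec ed da db dc] := model_relations N_gt0.
have [|f fP _] := @presented_universal _ rels7 (model N) gen_image; last by exists f.
move=> s t; rewrite !inE.
by do 6?[case/orP]; move=> /eqP[-> ->].
Qed.

Lemma filt_el i m : filt i (homog_el N i m).
Proof. by split=> //; exists (map_mx polyC m). Qed.

Lemma filt_image (f : {additive Lie57 -> model N}) :
  (forall x y, f (x ** y) = f x ** f y) ->
  (forall g, f (pgen rels7 g) = gen_image g) ->
  forall i x, x \in lcs i.+1 -> filt i.+1 (f x).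
Proof.
move=> f_lie f_gen.
have filt1 x : filt 1 (f x).
  elim/Lie57_ind: x; try by rewrite f_gen; apply: filt_el.
  - by rewrite raddf0; apply: filt0.
  - by move=> x y; rewrite raddfB; apply: filtB.
  - by move=> x y Fx Fy; rewrite f_lie; apply/filtS/(filt_lie Fx Fy).
elim=> [|i IHi] x; first by move=> _; apply: filt1.
move=> /asboolP; elim=> {x} [_ [x [y [Lx _ ->]]]||x y _ Fx _ Fy].
- by rewrite f_lie -addn1; apply: filt_lie => //; apply: IHi.
- by rewrite raddf0; apply: filt0.
- by rewrite raddfB; apply: filtB.
Qed.

End ToModel.

End Lie57.

Lemma el_zmod_morphism N i : zmod_morphism (homog_el N i).
Proof.
move=> m p; apply: injective_projections; last by rewrite /= subr0.
by rewrite /= /homog map_mxB scalerBr.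
Qed.

HB.instance Definition _ N i :=
  GRing.isZmodMorphism.Build _ _ (homog_el N i) (el_zmod_morphism N i).

Lemma filt_homog_eq0 N i m z :
  filt i.+1 ((homog i m, z) : model N) -> m = 0.
Proof. by case=> -[p] /= /esym /homog_eq0. Qed.

Lemma mulrzmxE (m : 'M[int]_3) k r s : (m *~ k) r s = k * m r s.
Proof. by rewrite -scaler_int intz mxE. Qed.

Section Independence.
Variables A B C D E U V W Z : nat -> Lie57.
Hypothesis sys : table_system (pgen rels7 ga : Lie57) (pgen rels7 gb)
  (pgen rels7 gc) (pgen rels7 gd) (pgen rels7 ge) A B C D E U V W Z.

(** The images of the five elements in the model are multiples of linearly
    independent matrices. *)
Lemma odd_comb_inj n w : odd_comb A B C D E n w \in lcs n.*2.+2 -> w = 0.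
Proof.
have N1 : (0 < 1)%N by [].
have [f [f_lie f_gen]] := to_model N1.
move=> /(filt_image f_lie f_gen).
have := table_system_map f_lie sys; rewrite !f_gen => fsys.
have [/= fB fD] := model_BD N1 fsys n.
(* In degree 1 the generators have the images ma, mc and me, in higher odd
   degrees A, C and E have the images 2 ma, mk and 2 me. *)
pose ka : int := if n is 0 then 1 else 2.
pose km := if n is 0 then mc else mk.
have [fA fC fE] : [/\ f (A n) = homog_el 1 n.*2.+1 (ma *~ ka),
    f (C n) = homog_el 1 n.*2.+1 km & f (E n) = homog_el 1 n.*2.+1 (me *~ ka)].
  rewrite /ka /km; case: n {w fB fD ka km} => [|n].
    by rewrite (A_0 sys) (C_0 sys) (E_0 sys) !f_gen !mulr1z.
  by have [] := model_ACE N1 fsys n.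
rewrite /odd_comb !raddfD !raddfMz /= fA fB fC fD fE -!raddfMz -!raddfD.
move=> /filt_homog_eq0 /matrixP eq0.
have := eq0 0 1; have := eq0 0 2; have := eq0 1 1; have := eq0 1 0; have := eq0 2 0.
rewrite !mxE !mulrzmxE /km /ka.
case: w {eq0} => [[[[p q] r] s] t]; case: n {ka km fA fB fC fD fE} => [|n].
all: rewrite !mxE /= ?intz ?mulrzz => t0 s0 r0 p0 q0.
all: have [-> -> ->] : [/\ p = 0, q = 0 & r = 0] by split; lia.
all: by have [-> ->] : s = 0 /\ t = 0 by split; lia.
Qed.

(** The matrix parts of [U n], [V n] and [W n] are independent, and in the model
    with [N = n] the image of [Z n] is 2 modulo [2n+2], of order [n.+1]. *)
Lemma even_comb_inj n w : @even_comb _ U V W Z n w \in lcs n.*2.+3 -> w = 0.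
Proof.
(* For n = 0 any positive N will do, as the cyclic group is trivial. *)
pose N := maxn n 1.
have N_gt0 : (0 < N)%N by rewrite leq_maxr.
have [f [f_lie f_gen]] := to_model N_gt0.
move=> /(filt_image f_lie f_gen).
have := table_system_map f_lie sys; rewrite !f_gen => fsys.
have [/= fU fW] := model_UW N_gt0 fsys n.
have /= fV := model_V N_gt0 fsys n.
have /= fZ := model_Z N_gt0 fsys n.
case: w => [[[k p] q] r]; rewrite /even_comb !raddfD !raddfMz raddfMn /=.
rewrite fU fV fW fZ -!raddfMz -!addrA -!raddfD.
have -> : ((0, z_value N n) : model N) *+ (k : 'I_n.+1) =
    (0, z_value N n *+ (k : 'I_n.+1)).
  elim: (k : nat) => [|j IHj]; first by rewrite !mulr0n.
  by rewrite !mulrSr IHj; apply: injective_projections; rewrite /= ?addr0.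
have homog_sum (m : 'M[int]_3) (z : 'Z_(N.+1.*2)) :
    ((0, z) : model N) + homog_el N n.*2.+2 m = (homog n.*2.+2 m, z).
  by apply: injective_projections; rewrite /= ?add0r ?addr0.
rewrite homog_sum => Fw.
have /matrixP eq0 := filt_homog_eq0 Fw.
have := eq0 0 1; have := eq0 2 2; have := eq0 1 0.
rewrite !mxE !mulrzmxE !mxE /= => r0 q0 p0.
have [-> -> ->] : [/\ p = 0, q = 0 & r = 0] by split; lia.
suff -> : k = 0 by [].
case: n @N N_gt0 k Fw {eq0 p0 q0 r0 f f_lie f_gen fsys fU fW fV fZ homog_sum}.
  by move=> *; apply: ord1.
move=> n N N_gt0 k [_ /=].
have NE : N = n.+1 by rewrite /N maxnC; apply/maxn_idPr.
rewrite /z_value NE eqxx => /(_ (ltnSn _)) /eqP.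
have ltk : (2 * (k : 'I_n.+2) < n.+2.*2)%N by have := ltn_ord (k : 'I_n.+2); lia.
rewrite -mulrnA -val_eqE /= val_Zp_nat // modn_small // muln_eq0 => /eqP k0.
exact: val_inj.
Qed.

End Independence.

Lemma lcs_factor_Lie57 n :
  zmod_isog (lcs_factor Lie57 n.*2.+1) (int * int * int * int * int)%type /\
  zmod_isog (lcs_factor Lie57 n.*2.+2) (cyclic_zmod n.+1 * int * int * int)%type.
Proof.
have rel := Lie57_relations.
have [A [B [C [D [E [U [V [W [Z sys]]]]]]]]] := table_system_exists
  (pgen rels7 ga : Lie57) (pgen rels7 gb) (pgen rels7 gc) (pgen rels7 gd)
  (pgen rels7 ge).
have spanned i x : x \in lcs i.+1 ->
    exists2 y, in_zspan (graded_span A B C D E U V W Z i.+1) y & x - y \in lcs i.+2.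
  apply: lcs_spanned => [y|j y g]; last exact: (graded_span_lie rel sys).
  apply: Lie57_span => z; rewrite /graded_span /graded_gens /=.
  by rewrite (A_0 sys) (B_0 sys) (C_0 sys) (D_0 sys) (E_0 sys).
split.
  apply: (@subquotient_isog _ _ _ _ (odd_comb_additive A B C D E n)) => [w|x Lx|w].
  - exact: odd_comb_lcs sys n w.
  - by have [y /odd_comb_surj[w <-]] := spanned _ x Lx; exists w.
  - exact: (odd_comb_inj sys).
apply: (@subquotient_isog _ _ _ _ (even_comb_additive rel sys n)) => [w|x Lx|w].
- exact: even_comb_lcs sys n w.
- by have [y /(even_comb_surj rel sys)[w <-]] := spanned _ x Lx; exists w.
- exact: (even_comb_inj sys).
Qed.

Theorem theorem6p1 (i : nat) (i_ge1 : (1 <= i)%N) (i_le67 : (i <= 67)%N) :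
  (~~ odd i ->
     zmod_isog (lcs_factor Lie57 i) (cyclic_zmod i./2 * int * int * int)%type) /\
  (odd i ->
     zmod_isog (lcs_factor Lie57 i) (int * int * int * int * int)%type).
Proof.
split=> [even_i|odd_i].
  have iE : i = i./2.-1.*2.+2 by lia.
  have [_] := lcs_factor_Lie57 i./2.-1; rewrite -iE prednK //; lia.
have iE : i = i./2.*2.+1 by lia.
by have [] := lcs_factor_Lie57 i./2; rewrite -iE.
Qed.
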